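(* Let $n$ be a positive integer. Then $$\sum_{0 \le k_1 < \dots < k_n} R^{\ast}_{(k_{1},\ldots,k_{n})}(x_{1},\ldots,x_{n};1,1,w)= \prod_{i=1}^{n} \frac{1}{1-x_i} \prod_{1 \le i < j \le n} \frac{1}{1-x_i x_j}\; Z_{\mathrm{DSASM}} (x_1,\dots,x_n),$$ where the sum is over all strictly increasing sequences of $n$ nonnegative integers and $Z_{\mathrm{DSASM}}$ is the partition function of DSASMs of order $n$.
   Context: **Modified Robbins polynomials.** For a sequence of integers $\boldsymbol{k}=(k_1,\dots,k_n)$, $$R_{\boldsymbol{k}}^{\ast}(x_{1},\ldots,x_{n};u,v,w)=\frac{\mathbf{ASym}_{x_{1},\ldots,x_{n}}\left[\prod_{1\le i<j\le n}(u x_{i}x_{j}+v+w x_{i})\prod_{i=1}^{n}x_{i}^{k_{i}}\right]}{\prod_{1\le i<j\le n}(x_{j}-x_{i})},$$ where $\mathbf{ASym}_{x_1,\ldots,x_n} F(x_1,\dots,x_n)=\sum_{\sigma\in\mathfrak S_n}\operatorname{sgn}(\sigma)F(x_{\sigma(1)},\dots,x_{\sigma(n)})$. The infinite sum is a formal power series in the indeterminates $x_1,\dots,x_n$. **Triangular grid.** $\mathcal T_n$ is the graph whose vertices carry matrix coordinates (row, column), rows numbered downwards: top vertices $(0,j)$ for $1\le j\le n$; left boundary vertices $(i,i)$ for $1\le i\le n$; bulk vertices $(i,j)$ for $1\le i<j\le n$; right boundary vertices $(i,n+1)$ for $1\le i\le n$. For all $1\le i\le j\le n$ there is a vertical edge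 between $(i-1,j)$ and $(i,j)$ and a horizontal edge between $(i,j)$ and $(i,j+1)$. Thus top and right boundary vertices have degree $1$, each left boundary vertex has degree $2$ (one edge upwards, one edge to the right), and each bulk vertex has degree $4$. **Six-vertex configurations.** A six-vertex model configuration on $\mathcal T_n$ is an orientation of the edges such that each top vertex has indegree $1$, each right boundary vertex has outdegree $1$, and each bulk vertex has indegree and outdegree both equal to $2$. (These configurations are in bijection with diagonally symmetric alternating sign matrices, DSASMs, of order $n$.) **Weights.** Put $\tau(x)=\sqrt{-1-w x-x^2}$; fix one choice of each square root $\tau(x_i)$ and of $\sqrt{w+2}$. The weight of a configuration is the product of its vertex weights: - top and right boundary vertices have weight $1$; - a bulk vertex at $(i,j)$ has weight, with $x=x_i$, $y=x_j$: - $\tau(x)\tau(y)$ if both vertical edges point away from the vertex and both horizontal edges point into it, or if both vertical edges point into it and both horizontal edges point away from it; - $x+y+wxy$ if the vertical edges are both directed upwards and the horizontal edges both to the right, or the vertical edges are both directed downwards and the horizontal edges both to the left; - $1-xy$ if the vertical edges are both directed upwards and the horizontal edges both to the left, or the vertical edges are both directed downwards and the horizontal edges both to the right; - a left boundary vertex at $(i,i)$ has weight, with $x=x_i$: - $1$ if its upper edge points away from the vertex and its right edge points into it; - $-1$ if its upper edge points into the vertex and its right edge points away from it; - $\sqrt{w+2}\,\frac{x}{\tau(x)}$ if both edges point away from the vertex, or both point into it. The partition function $Z_{\mathrm{DSASM}}(x_1,\dots,x_n)$ is the sum of the weights of all six-vertex model configurations on $\mathcal T_n$. *)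

(* Defs.v *)
From HB Require Import structures.
From mathcomp Require Import all_boot all_order all_fingroup all_algebra.
From mathcomp Require Import boolp.
From mathcomp.multinomials Require Import mpoly.

Set Implicit Arguments.
Unset Strict Implicit.
Unset Printing Implicit Defensive.

Import GRing.Theory.
Local Open Scope ring_scope.

Record mfps (n : nat) (K : Type) := MFps { mfps_coef :> 'X_{1..n} -> K }.

Lemma mfpsP (n : nat) (K : Type) (f g : mfps n K) : f =1 g -> f = g.
Proof. by case: f g => [f] [g] /= /funext ->. Qed.

HB.instance Definition _ (n : nat) (K : Type) := gen_eqMixin (mfps n K).
HB.instance Definition _ (n : nat) (K : Type) := gen_choiceMixin (mfps n K).

Section MfpsRing.
Context (n : nat) (K : comNzRingType).
Implicit Types (f g h : mfps n K) (m : 'X_{1..n}) (p q : {mpoly K[n]}).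

Definition mfps_zero : mfps n K := MFps (fun=> 0).
Definition mfps_opp f : mfps n K := MFps (fun m => - f m).
Definition mfps_add f g : mfps n K := MFps (fun m => f m + g m).

Fact mfps_addA : associative mfps_add.
Proof. by move=> f g h; apply: mfpsP => m /=; rewrite addrA. Qed.
Fact mfps_addC : commutative mfps_add.
Proof. by move=> f g; apply: mfpsP => m /=; rewrite addrC. Qed.
Fact mfps_add0 : left_id mfps_zero mfps_add.
Proof. by move=> f; apply: mfpsP => m /=; rewrite add0r. Qed.
Fact mfps_addN : left_inverse mfps_zero mfps_opp mfps_add.
Proof. by move=> f; apply: mfpsP => m /=; rewrite addNr. Qed.

HB.instance Definition _ := GRing.isZmodule.Build (mfps n K)
  mfps_addA mfps_addC mfps_add0 mfps_addN.

Definition mfps_of_mpoly p : mfps n K := MFps (fun m => p@_m).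

(* Only pairs of monomials of degree at most that of m can multiply to m, so
   the bounded index type loses no term. *)
Definition mfps_mul f g : mfps n K :=
  MFps (fun m => \sum_(k : 'X_{1..n < (mdeg m).+1, (mdeg m).+1}
                       | m == (k.1 + k.2)%MM) f k.1 * g k.2).

Definition mfps_trunc (d : nat) f : {mpoly K[n]} :=
  \sum_(m : 'X_{1..n < d}) f m *: 'X_[m].

Lemma mcoeff_trunc d f m : (mdeg m < d)%N -> (mfps_trunc d f)@_m = f m.
Proof. exact: mcoeff_mpoly. Qed.

Lemma mcoeffM_eq d p p' q q' m :
  (forall m', (mdeg m' < d)%N -> p@_m' = p'@_m') ->
  (forall m', (mdeg m' < d)%N -> q@_m' = q'@_m') ->
  (mdeg m < d)%N -> (p * q)@_m = (p' * q')@_m.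
Proof.
move=> eqp eqq ltmd; rewrite !mcoeffM; apply: eq_bigr => k _.
by rewrite eqp ?eqq //; apply: leq_trans (bmdeg _) ltmd.
Qed.

Lemma mfps_mulE d f g m : (mdeg m < d)%N ->
  mfps_mul f g m = (mfps_trunc d f * mfps_trunc d g)@_m.
Proof.
move=> ltmd; rewrite mcoeffM; apply: eq_bigr => k _.
by rewrite !mcoeff_trunc //; apply: leq_trans (bmdeg _) ltmd.
Qed.

Lemma mfps_of_mpolyM p q :
  mfps_of_mpoly (p * q) = mfps_mul (mfps_of_mpoly p) (mfps_of_mpoly q).
Proof. by apply: mfpsP => m; rewrite /= mcoeffM. Qed.

Fact mfps_mulA : associative mfps_mul.
Proof.
move=> f g h; apply: mfpsP => m.
rewrite !(@mfps_mulE (mdeg m).+1) //.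
transitivity ((mfps_trunc (mdeg m).+1 f *
  (mfps_trunc (mdeg m).+1 g * mfps_trunc (mdeg m).+1 h))@_m).
  apply: (@mcoeffM_eq (mdeg m).+1) => // m' lt.
  by rewrite mcoeff_trunc // (mfps_mulE _ _ lt).
rewrite mulrA; apply: (@mcoeffM_eq (mdeg m).+1) => // m' lt.
by rewrite mcoeff_trunc // (mfps_mulE _ _ lt).
Qed.

Fact mfps_mulC : commutative mfps_mul.
Proof.
by move=> f g; apply: mfpsP => m; rewrite !(@mfps_mulE (mdeg m).+1) // mulrC.
Qed.

Fact mfps_mul1 : left_id (mfps_of_mpoly 1) mfps_mul.
Proof.
move=> f; apply: mfpsP => m; rewrite (@mfps_mulE (mdeg m).+1) //.
rewrite -[RHS](@mcoeff_trunc (mdeg m).+1) // -[X in _ = X@__]mul1r.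
by apply: (@mcoeffM_eq (mdeg m).+1) => // m' lt; rewrite mcoeff_trunc.
Qed.

Fact mfps_mulDl : left_distributive mfps_mul mfps_add.
Proof.
move=> f g h; apply: mfpsP => m /=; rewrite -big_split /=.
by apply: eq_bigr => k _; rewrite mulrDl.
Qed.

Fact mfps_oner_neq0 : mfps_of_mpoly 1 != mfps_zero.
Proof.
apply/eqP => /(congr1 (fun f : mfps n K => f 0%MM)) /= /eqP.
by rewrite mcoeff1 eqxx oner_eq0.
Qed.

HB.instance Definition _ := GRing.Zmodule_isComNzRing.Build (mfps n K)
  mfps_mulA mfps_mulC mfps_mul1 mfps_mulDl mfps_oner_neq0.

Fact mfps_of_mpoly_additive : {morph mfps_of_mpoly : p q / p - q}.
Proof. by move=> p q; apply: mfpsP => m; rewrite /= mcoeffB. Qed.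

HB.instance Definition _ := GRing.isZmodMorphism.Build
  {mpoly K[n]} (mfps n K) mfps_of_mpoly mfps_of_mpoly_additive.
HB.instance Definition _ := GRing.isMonoidMorphism.Build
  {mpoly K[n]} (mfps n K) mfps_of_mpoly (conj erefl mfps_of_mpolyM).

Lemma mfpsD f g m : (f + g) m = f m + g m. Proof. by []. Qed.
Lemma mfpsN f m : (- f) m = - f m. Proof. by []. Qed.
Lemma mfpsM f g m : (f * g) m =
  \sum_(k : 'X_{1..n < (mdeg m).+1, (mdeg m).+1} | m == (k.1 + k.2)%MM)
     f k.1 * g k.2.
Proof. by []. Qed.

Lemma mfps_sum (I : Type) (r : seq I) (P : pred I) (F : I -> mfps n K) m :
  (\sum_(i <- r | P i) F i) m = \sum_(i <- r | P i) F i m.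
Proof. exact: (big_morph (fun f : mfps n K => f m)). Qed.

Definition mfpsC (c : K) : mfps n K := mfps_of_mpoly c%:MP.
Definition mfpsX (i : 'I_n) : mfps n K := mfps_of_mpoly 'X_i.

Lemma mfpsM0 f g : (f * g) 0%MM = f 0%MM * g 0%MM.
Proof.
rewrite mfpsM (bigD1 (bm0, bm0)) /= ?addm0 ?eqxx // big1 ?addr0 //.
move=> [k1 k2] /= /andP[e] /eqP []; move: e; rewrite eq_sym mnmD_eq0.
by case/andP=> /eqP e1 /eqP e2; congr (_, _); apply: val_inj.
Qed.

Lemma mfps_exp_vanish f (k : nat) m :
  f 0%MM = 0 -> (mdeg m < k)%N -> (f ^+ k) m = 0.
Proof.
move=> f0; elim: k m => [|k IHk] m // ltmk.
rewrite exprS mfpsM big1 // => -[k1 k2] /= /eqP e.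
have [/eqP|k1_gt0] := posnP (mdeg k1).
  by rewrite mdeg_eq0 => /eqP ->; rewrite f0 mul0r.
rewrite IHk ?mulr0 //; apply: leq_trans (ltmk : (mdeg m <= k)%N).
rewrite [X in (_ <= mdeg X)%N]e mdegD.
by rewrite -[X in (X <= _)%N]add1n leq_add2r.
Qed.

Lemma mfpsM_eq f g h m :
  (forall m', (mdeg m' <= mdeg m)%N -> g m' = h m') -> (f * g) m = (f * h) m.
Proof.
by move=> eqgh; rewrite !mfpsM; apply: eq_bigr => k _; rewrite eqgh // -ltnS bmdeg.
Qed.

End MfpsRing.

Section MfpsUnit.
Context (n : nat) (K : comUnitRingType).
Implicit Types (f g : mfps n K).

Definition mfps_unit : pred (mfps n K) := fun f => f 0%MM \is a GRing.unit.

(* Geometric series: with c = f(0) and h = 1 - f/c, which has no constant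
   term, 1/f is the sum of all c^-1 h^k; the powers h^k with k > mdeg m do not
   contribute to the coefficient of m. *)
Definition mfps_inv f : mfps n K :=
  if mfps_unit f then
    MFps (fun m => (mfpsC n (f 0%MM)^-1 *
      \sum_(k < (mdeg m).+1) (1 - mfpsC n (f 0%MM)^-1 * f) ^+ k) m)
  else f.

Fact mfps_mulVx : {in mfps_unit, left_inverse 1 mfps_inv *%R}.
Proof.
move=> f uf; rewrite mulrC /mfps_inv (uf : mfps_unit f).
set c := mfpsC n _; set h := 1 - _; apply: mfpsP => m.
have h0 : h 0%MM = 0.
  rewrite mfpsD mfpsN mfpsM0 /= mcoeff1 mcoeffC eqxx mulr1 mulVr //.
  by rewrite subrr.
rewrite (@mfpsM_eq _ _ f _ (c * \sum_(k < (mdeg m).+1) h ^+ k)); last first.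
  move=> m' le; transitivity ((c * \sum_(k < (mdeg m').+1) h ^+ k) m') => //.
  apply: mfpsM_eq => m'' le'.
  rewrite !mfps_sum -!(big_mkord xpredT (fun k => (h ^+ k) m'')).
  rewrite [RHS](@big_cat_nat _ _ _ (mdeg m').+1) //= [X in _ = _ + X]big_nat_cond.
  rewrite [X in _ = _ + X]big1 ?addr0 // => k /andP[/andP[lt _] _].
  by rewrite mfps_exp_vanish //; apply: leq_ltn_trans le' lt.
have -> : f * (c * \sum_(k < (mdeg m).+1) h ^+ k) = 1 - h ^+ (mdeg m).+1.
  have hE : 1 - h = c * f by rewrite /h subKr.
  by rewrite -[RHS]opprB subrX1 -mulNr opprB hE mulrCA mulrA.
by rewrite mfpsD mfpsN mfps_exp_vanish // subr0.
Qed.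

Fact mfps_unitPl (f g : mfps n K) : g * f = 1 -> mfps_unit f.
Proof.
move/(congr1 (fun f : mfps n K => f 0%MM)); rewrite mfpsM0 /= mcoeff1 eqxx.
by move=> gf; apply/unitrPr; exists (g 0%MM); rewrite mulrC.
Qed.

Fact mfps_invr_out : {in [predC mfps_unit], mfps_inv =1 id}.
Proof. by move=> f nuf; rewrite /mfps_inv (negbTE (nuf : ~~ mfps_unit f)). Qed.

HB.instance Definition _ := GRing.ComNzRing_hasMulInverse.Build (mfps n K)
  mfps_mulVx mfps_unitPl mfps_invr_out.

End MfpsUnit.

(* The family (F i), i in P, is locally finite (each monomial occurs in finitely
   many members) and S is its sum. *)
Definition mfps_has_sum (n : nat) (K : comNzRingType) (I : eqType)
    (P : {pred I}) (F : I -> mfps n K) (S : mfps n K) : Prop :=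
  forall m : 'X_{1..n}, exists J : seq I,
    [/\ uniq J,
        {subset J <= P},
        forall i, i \in P -> i \notin J -> F i m = 0
      & S m = \sum_(i <- J) F i m].

Section Robbins.
Context (n : nat) (K : idomainType).

Definition asym (p : {mpoly K[n]}) : {mpoly K[n]} :=
  \sum_(s : 'S_n) (-1) ^+ s * msym s p.

Definition vandermonde : {mpoly K[n]} :=
  \prod_(i < n) \prod_(j < n | (i < j)%N) ('X_j - 'X_i).

Definition robbins_kernel (k : n.-tuple nat) (u v w : K) : {mpoly K[n]} :=
  (\prod_(i < n) \prod_(j < n | (i < j)%N)
     (u%:MP * 'X_i * 'X_j + v%:MP + w%:MP * 'X_i)) *
  \prod_(i < n) 'X_i ^+ tnth k i.

End Robbins.

Lemma alternant_dvd (R : comNzRingType) (n : nat) (x : 'I_n -> R)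
    (f : 'I_n -> {poly R}) :
  exists q, q * \prod_(i < n) \prod_(j < n | (i < j)%N) (x j - x i)
            = \det (\matrix_(i, j) (f j).[x i]).
Proof.
elim: n x f => [|n IHn] x f; first by exists 1; rewrite big_ord0 mulr1 det_mx00.
have /fin_all_exists[g gE] j :
    exists g, f j - (f j).[x ord0]%:P = g * ('X - (x ord0)%:P).
  by apply/factor_theorem; rewrite /root !hornerE subrr.
have gxE i j : (f j).[x i] - (f j).[x ord0] = (g j).[x i] * (x i - x ord0).
  by have /(congr1 (horner^~ (x i))) := gE j; rewrite !hornerE.
set A := \matrix_(i, j) _.
pose C : 'M[R]_n.+1 :=
  \matrix_(i, j) ((i == j)%:R - ((i != ord0) && (j == ord0))%:R).
have trC : is_trig_mx C.
  apply/is_trig_mxP => i j ltij; rewrite mxE.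
  have /negbTE -> : i != j by rewrite -val_eqE /= ltn_eqF.
  have /negbTE -> : j != ord0 by rewrite -val_eqE /= -lt0n (leq_ltn_trans _ ltij).
  by rewrite andbF subrr.
have detC : \det C = 1.
  rewrite det_trig // big1 // => i _; rewrite mxE eqxx.
  by case: (i == ord0); rewrite subr0.
have -> : \det A = \det (C *m A) by rewrite det_mulmx detC mul1r.
have CAE i j : (C *m A) i j
    = (f j).[x i] - (i != ord0)%:R * (f j).[x ord0].
  rewrite mxE.
  under eq_bigr => k _ do rewrite !mxE mulrBl.
  rewrite sumrB; congr (_ - _).
    rewrite (bigD1 i) //= eqxx mul1r big1 ?addr0 // => k ki.
    by rewrite eq_sym (negbTE ki) mul0r.
  rewrite (bigD1 ord0) //= eqxx andbT big1 ?addr0 // => k ki.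
  by rewrite (negbTE ki) andbF mul0r.
have /fin_all_exists[q qE] (j : 'I_n.+1) :=
  IHn (fun i => x (lift ord0 i)) (fun k : 'I_n => g (lift j k)).
exists (\sum_j (f j).[x ord0] * ((-1) ^+ (0 + j) * q j)).
rewrite (expand_det_row _ ord0) mulr_suml; apply: eq_bigr => j _.
rewrite CAE eqxx mul0r subr0 -!mulrA; congr (_ * _).
rewrite /cofactor; congr (_ * _).
have -> : row' ord0 (col' j (C *m A)) =
    diag_mx (\row_i (x (lift ord0 i) - x ord0)) *m
    \matrix_(i, k) (g (lift j k)).[x (lift ord0 i)].
  apply/matrixP => i k; rewrite mxE mxE CAE mul_diag_mx !mxE /= mul1r gxE.
  by rewrite mulrC.
rewrite det_mulmx -qE det_diag [RHS]mulrCA; congr (_ * _).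
rewrite big_ord_recl; congr (_ * _).
  rewrite big_mkcond big_ord_recl /= mul1r; apply: eq_bigr => i _.
  by rewrite mxE.
apply: eq_bigr => i _; rewrite big_mkcond big_ord_recl /= mul1r.
by rewrite [RHS]big_mkcond.
Qed.

Lemma asym_dvd (n : nat) (K : idomainType) (p : {mpoly K[n]}) :
  exists q, q * vandermonde n K == asym p.
Proof.
have asX (m : 'X_{1..n}) : exists q, q * vandermonde n K = asym 'X_[m].
  have [q qE] := alternant_dvd (fun i : 'I_n => 'X_i : {mpoly K[n]})
    (fun i => 'X^(m i)).
  exists q; rewrite {1}/vandermonde qE -det_tr; apply: eq_bigr => s _.
  congr (_ * _); rewrite /msym mmapX /mmap1; apply: eq_bigr => i _.
  by rewrite !mxE hornerXn.
have -> : asym p = \sum_(m <- msupp p) p@_m *: asym 'X_[m].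
  rewrite /asym {1}(mpolyE p).
  under eq_bigr => s _ do rewrite raddf_sum /= mulr_sumr.
  rewrite exchange_big; apply: eq_bigr => m _; rewrite scaler_sumr.
  by apply: eq_bigr => s _; rewrite msymZ scalerAr.
elim: (msupp p) => [|m r [q /eqP qE]].
  by exists 0; rewrite big_nil mul0r.
have [q' q'E] := asX m; exists (p@_m *: q' + q).
by rewrite big_cons mulrDl qE -scalerAl q'E.
Qed.

Definition robbins (n : nat) (K : idomainType) (k : n.-tuple nat) (u v w : K)
    : {mpoly K[n]} :=
  xchoose (asym_dvd (robbins_kernel k u v w)).

Lemma robbinsE (n : nat) (K : idomainType) (k : n.-tuple nat) (u v w : K) :
  robbins k u v w * vandermonde n K = asym (robbins_kernel k u v w).
Proof. exact: eqP (xchooseP (asym_dvd (robbins_kernel k u v w))). Qed.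

Lemma vandermonde_neq0 (n : nat) (K : idomainType) : vandermonde n K != 0.
Proof.
apply/prodf_neq0 => i _; apply/prodf_neq0 => j ltij.
rewrite subr_eq0; apply/eqP => /(congr1 (fun p : {mpoly K[n]} => p@_U_(j)%MM)).
rewrite !mcoeffXU eqxx.
have /negbTE -> : i != j by rewrite -val_eqE /= ltn_eqF.
by move/eqP; rewrite oner_eq0.
Qed.

Lemma robbins_unique (n : nat) (K : idomainType) (k : n.-tuple nat) (u v w : K)
    (q : {mpoly K[n]}) :
  q * vandermonde n K = asym (robbins_kernel k u v w) -> q = robbins k u v w.
Proof. by rewrite -robbinsE => /(mulIf (vandermonde_neq0 n K)). Qed.

(* (row, column), rows numbered downwards *)
Definition vertex := (nat * nat)%type.

Definition grid_index (n : nat) := {p : 'I_n * 'I_n | (p.1 <= p.2)%N}.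

(* [inl] for the vertical edges and [inr] for the horizontal ones; the index
   (i, j), counted from 0, stands for the matrix coordinates (i+1, j+1). *)
Definition edge (n : nat) := (grid_index n + grid_index n)%type.

Definition endpoints (n : nat) (e : edge n) : vertex * vertex :=
  match e with
  | inl p => let: (i, j) := val p in ((i : nat, j.+1), (i.+1, j.+1))
  | inr p => let: (i, j) := val p in ((i.+1, j.+1), (i.+1, j.+2))
  end.

(* [true]: from the first endpoint to the second, i.e. downwards or to the
   right. *)
Definition orientation (n : nat) := {ffun edge n -> bool}.

Section SixVertex.
Context (n : nat).
Implicit Types (o : orientation n) (a b : vertex).

Definition tail o (e : edge n) : vertex :=
  if o e then (endpoints e).1 else (endpoints e).2.
Definition head o (e : edge n) : vertex :=
  if o e then (endpoints e).2 else (endpoints e).1.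

Definition indegree o a := #|[set e | head o e == a]|.
Definition outdegree o a := #|[set e | tail o e == a]|.

Definition six_vertex o : bool :=
  [&& [forall j : 'I_n, indegree o (0%N, j.+1) == 1%N],
      [forall i : 'I_n, outdegree o (i.+1, n.+1) == 1%N]
    & [forall i : 'I_n, forall j : 'I_n, (i < j)%N ==>
         (indegree o (i.+1, j.+1) == 2) && (outdegree o (i.+1, j.+1) == 2)]].

Definition arrow o a b : bool := [exists e, (tail o e == a) && (head o e == b)].

Section Weights.
Context (A : comUnitRingType) (w s : A) (x tau : 'I_n -> A).

(* [s] and [tau i] play the roles of sqrt (w + 2) and
   sqrt (- 1 - w * x i - x i ^+ 2). The booleans record whether the upper and
   lower edges point upwards and the left and right edges point rightwards. *)
Definition bulk_weight o (i j : 'I_n) : A :=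
  let up    := arrow o (i.+1, j.+1) (i : nat, j.+1) in
  let down  := arrow o (i.+2, j.+1) (i.+1, j.+1) in
  let left  := arrow o (i.+1, j : nat) (i.+1, j.+1) in
  let right := arrow o (i.+1, j.+1) (i.+1, j.+2) in
  match up, down, left, right with
  | true, false, true, false | false, true, false, true => tau i * tau j
  | true, true, true, true | false, false, false, false =>
      x i + x j + w * x i * x j
  | true, true, false, false | false, false, true, true => 1 - x i * x j
  | _, _, _, _ => 0 (* excluded by [six_vertex] *)
  end.

Definition left_weight o (i : 'I_n) : A :=
  let up    := arrow o (i.+1, i.+1) (i : nat, i.+1) in
  let right := arrow o (i.+1, i.+1) (i.+1, i.+2) in
  match up, right with
  | true, false => 1
  | false, true => -1
  | true, true | false, false => s * (x i / tau i)
  end.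

(* The top and right boundary vertices have weight 1. *)
Definition config_weight o : A :=
  (\prod_(i < n) left_weight o i) *
  \prod_(i < n) \prod_(j < n | (i < j)%N) bulk_weight o i j.

Definition Z_DSASM : A := \sum_(o : orientation n | six_vertex o) config_weight o.

End Weights.
End SixVertex.

(* Main.v *)
Require Import Defs.
From HB Require Import structures.
From mathcomp Require Import all_boot all_order all_fingroup all_algebra.
From mathcomp Require Import boolp ring.
From mathcomp.multinomials Require Import mpoly.

Set Implicit Arguments.
Unset Strict Implicit.
Unset Printing Implicit Defensive.

Import Order.TTheory GRing.Theory.
Local Open Scope ring_scope.

(** Write L(x_1, .., x_n) for the left-hand side and Z(x_1, .., x_n) for the
    partition function.  The monomials with strictly increasing exponents add
    up to a rational function G in which the product of all variables occurs
    through the symmetric factor 1 / (1 - x_1 .. x_n), and dividing an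
    antisymmetriser by the Vandermonde product turns it into a symmetriser.
    Sorting the permutations by the variable that they put first gives

      (1 - x_1 .. x_n) L = sum over i of
        prod over j <> i of x_j (1 + w x_i + x_i x_j) / (x_j - x_i)
        times L without x_i.

    Hence it suffices that Z satisfies the recursion which this one becomes
    after multiplication by prod (1 - x_i) prod (1 - x_i x_j), namely
    [Zpol_recursion]; [littlewood_sum] is the resulting induction.

    The recursion is proved by polynomial interpolation in one variable x.
    Four properties of Z are needed: it is symmetric, it has degree less than n
    in each variable, setting a variable to 0 removes it, and setting x y = 1
    removes the pair x, y at the cost of an explicit factor.  With them one
    first interpolates the value at x = 1 ([Zpol_cons1]); then both sides of the
    recursion, cleared of denominators, have degree at most 2 n - 1 in x, and they
    agree at 0, at 1, at the other variables and at their inverses.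

    For the four properties the lattice is read as n lines: line i comes
    down column i, turns at the left boundary and leaves along row i.  A bit on
    each edge tells whether its arrow points away from the top end of its line,
    and the partition function is computed row by row ([grid]).  Only the
    first row contains the parameter of the first line, which gives the degree and
    the two specialisations.  Symmetry ([grid_exchange]) is the usual
    train argument: a crossing of two neighbouring lines put above the lattice
    is pushed down by the Yang-Baxter equation, through the diagonal
    by the reflection equation, and out on the right by Yang-Baxter again.

    Along each line the arrow reverses an even number of times, so the square
    roots tau can be moved from the weights into a gauge factor of the edges;
    what is left are polynomial weights in x_i and the square root s of w + 2
    ([gauge_grid]).  Finally, the recursion is used over the fraction
    field of the power series ring, which is an integral domain, and the
    infinite sum is compared with its rational value modulo high degree
    ([sum_powers_incr_series], [vanish_cancel]). *)

(** * Transfer recursion on lines *)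

Section TransferMatrix.
Variables (A : comNzRingType) (T : Type).
Variables (K : T -> bool -> bool -> A).
Variables (W : T -> T -> bool -> bool -> bool -> bool -> A).

(** The line [x] runs to the right through the columns [ys].  It enters with
    bit [h], the columns enter from above with bits [al], and [k] is the weight
    of the rest of the lattice as a function of the bits below the row; the line
    has to leave with bit [false].  In [W x y h b h' be] the arguments [h] and
    [h'] are the bits left and right of the vertex, [b] and [be] those above
    and below. *)
Fixpoint grid_row (x : T) (ys : seq T) (h : bool) (k : seq bool -> A)
    (al : seq bool) : A :=
  match ys, al with
  | y :: ys', b :: al' => \sum_(h' : bool) \sum_(be : bool)
      W x y h b h' be * grid_row x ys' h' (fun bs => k (be :: bs)) al'
  | _, _ => if h then 0 else k [::]
  end.

(** The first line of [xs] turns from column to row at its boundary vertex, of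
    weight [K], crosses the columns of all the other lines, and leaves a smaller
    lattice of the same shape. *)
Fixpoint grid (xs : seq T) (al : seq bool) : A :=
  match xs, al with
  | x :: xs', a :: al' => \sum_(h : bool) K x a h * grid_row x xs' h (grid xs') al'
  | _, _ => 1
  end.

Lemma eq_grid_row x ys h k k' al :
  k =1 k' -> grid_row x ys h k al = grid_row x ys h k' al.
Proof.
elim: ys h k k' al => [|y ys IH] h k k' [|b al] eqk //=; rewrite ?eqk //.
by apply: eq_bigr => h' _; apply: eq_bigr => be _; congr (_ * _); apply: IH => bs.
Qed.

Lemma eq_grid_row_size x ys h k k' al :
  size al = size ys -> (forall bs, size bs = size ys -> k bs = k' bs) ->
  grid_row x ys h k al = grid_row x ys h k' al.
Proof.
elim: ys h k k' al => [|y ys IH] h k k' [|b al] //= => [_|[sz]] eqk.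
  by rewrite eqk.
apply: eq_bigr => h' _; apply: eq_bigr => be _; congr (_ * _).
by apply: IH => // bs szb; rewrite eqk //= szb.
Qed.

Lemma grid_rowZ a x ys h (k : seq bool -> A) al :
  grid_row x ys h (fun bs => a * k bs) al = a * grid_row x ys h k al.
Proof.
elim: ys h k al => [|y ys IH] h k [|b al] /=; try by case: h; rewrite ?mulr0.
rewrite mulr_sumr; apply: eq_bigr => h' _; rewrite mulr_sumr.
by apply: eq_bigr => be _; rewrite IH mulrCA.
Qed.

Lemma grid_row_sum (I : Type) (r : seq I) (k : I -> seq bool -> A) x ys h al :
  grid_row x ys h (fun bs => \sum_(i <- r) k i bs) al
    = \sum_(i <- r) grid_row x ys h (k i) al.
Proof.
elim: ys h k al => [|y ys IH] h k [|b al] /=;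
  try by case: h => //; rewrite big1 // => i _.
rewrite [RHS]exchange_big; apply: eq_bigr => h' _.
by rewrite [RHS]exchange_big; apply: eq_bigr => be _; rewrite IH mulr_sumr.
Qed.

End TransferMatrix.

(** * Polynomial weights, Yang-Baxter and reflection equations *)

Section PolynomialWeights.
Variables (A : comNzRingType) (s : A).
Implicit Types (x y z : A) (xs ys : seq A) (al : seq bool).

Local Notation w := (s ^+ 2 - 2%:R).

(** Writing w as s ^ 2 - 2 turns the reflection equation, whose boundary weights
    contain s, into a polynomial identity in [s] and the line parameters. *)
Definition tau2 x : A := - 1 - w * x - x ^+ 2.
Definition aweight x y : A := x + y + w * x * y.

(** Along a line read from its top end, a reversal of the arrow would cost tau.
    Moving these factors to the edges leaves 1 for one of the two turning
    vertices and [tau2 x * tau2 y] for the other; see [gauge_bulk]. *)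
Definition poly_bulk x y (h b h' be : bool) : A :=
  match h, b, h', be with
  | false, false, false, false | true, true, true, true => 1 - x * y
  | true, false, true, false | false, true, false, true => aweight x y
  | true, false, false, true => 1
  | false, true, true, false => tau2 x * tau2 y
  | _, _, _, _ => 0
  end.

Definition poly_left x (a h : bool) : A :=
  match a, h with
  | false, false => 1
  | true, true => - tau2 x
  | _, _ => s * x
  end.

(** The vertex at which two neighbouring lines [x] and [y] cross outside of the
    lattice; it has the same anisotropy as the bulk, with 1 + w y + x y and
    x - y in the place of its two straight weights.  The gauge differs between
    vertical and horizontal edges, hence the flag. *)
Definition crossing (horizontal : bool) x y (b c : bool * bool) : A :=
  match b, c with
  | (false, false), (false, false) | (true, true), (true, true) => 1 + w * y + x * y
  | (false, true), (true, false) | (true, false), (false, true) => x - y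
  | (false, true), (false, true) => - tau2 (if horizontal then y else x)
  | (true, false), (true, false) => - tau2 (if horizontal then x else y)
  | _, _ => 0
  end.

Lemma sum_bool2 (F : bool * bool -> A) :
  \sum_(c : bool * bool) F c
   = F (true, true) + F (true, false) + F (false, true) + F (false, false).
Proof.
rewrite (eq_bigr (fun c => F (c.1, c.2))) => [|[a b] _] //.
by rewrite -(pair_bigA _ (fun a b => F (a, b))) /= !big_bool /= addrA.
Qed.

(** Both Yang-Baxter equations and the reflection equation are finite: one
    polynomial identity for each choice of the external bits. *)
Lemma yang_baxter_columns x0 x y h b h' be :
  \sum_(c : bool * bool) \sum_(h1 : bool)
     crossing false x y b c * (poly_bulk x0 x h c.1 h1 be.1 * poly_bulk x0 y h1 c.2 h' be.2)
  = \sum_(c : bool * bool) \sum_(h1 : bool)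
     poly_bulk x0 y h b.1 h1 c.1 * poly_bulk x0 x h1 b.2 h' c.2 * crossing false x y c be.
Proof.
rewrite !sum_bool2 !big_bool; move: h b h' be => [] [[] []] [] [[] []];
  rewrite /= ?(mul0r, mulr0, addr0, add0r) /tau2 /aweight //; ring.
Qed.

Lemma yang_baxter_rows x y z hg b hg' be :
  \sum_(c : bool * bool) \sum_(g : bool)
     crossing true x y hg c * (poly_bulk x z c.1 b hg'.1 g * poly_bulk y z c.2 g hg'.2 be)
  = \sum_(c : bool * bool) \sum_(g : bool)
     poly_bulk y z hg.1 b c.1 g * poly_bulk x z hg.2 g c.2 be * crossing true x y c hg'.
Proof.
rewrite !sum_bool2 !big_bool; move: hg b hg' be => [[] []] [] [[] []] [];
  rewrite /= ?(mul0r, mulr0, addr0, add0r) /tau2 /aweight //; ring.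
Qed.

(** Two neighbouring lines at the diagonal: both boundary vertices and the bulk
    vertex where the lines meet; [b] lists the bits entering from above, [c]
    those leaving to the right. *)
Definition corner x y (b c : bool * bool) : A :=
  \sum_(h : bool) \sum_(g : bool)
     poly_left x b.1 h * poly_bulk x y h b.2 c.1 g * poly_left y g c.2.

Lemma reflection x y b d :
  \sum_(c : bool * bool) crossing false x y b c * corner x y c d
  = \sum_(c : bool * bool) corner y x b c * crossing true x y c d.
Proof.
rewrite /corner !sum_bool2 !big_bool; move: b d => [[] []] [[] []];
  rewrite /= ?(mul0r, mulr0, addr0, add0r) /tau2 /aweight //; ring.
Qed.

End PolynomialWeights.

(** * Exchanging two neighbouring lines *)

Notation pgrid s := (grid (poly_left s) (poly_bulk s)).

Section Exchange.
Variables (A : comNzRingType) (s : A).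
Implicit Types (x y z : A) (xs ys : seq A) (al : seq bool).

Local Notation w := (s ^+ 2 - 2%:R).
Local Notation prow := (grid_row (poly_bulk s)).

(** The crossing passes a row by Yang-Baxter; what it does below that row is
    abstracted into the passage from [k] to [k']. *)
Lemma grid_row_exchange x0 x y p q h (k k' : seq bool -> A) pre b post :
  (forall pre' c bs, size pre' = size p ->
     \sum_d crossing s false x y c d * k (pre' ++ d.1 :: d.2 :: bs)
     = k' (pre' ++ c.1 :: c.2 :: bs)) ->
  size pre = size p ->
  \sum_(c : bool * bool) crossing s false x y b c *
     prow x0 (p ++ x :: y :: q) h k (pre ++ c.1 :: c.2 :: post)
  = prow x0 (p ++ y :: x :: q) h k' (pre ++ b.1 :: b.2 :: post).
Proof.
elim: p h k k' pre => [|z p IH] h k k' [|a pre] //= kk' => [_|[sz]].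
  transitivity (\sum_(h' : bool) \sum_(be : bool * bool)
     (\sum_(c : bool * bool) \sum_(h1 : bool)
     crossing s false x y b c *
       (poly_bulk s x0 x h c.1 h1 be.1 * poly_bulk s x0 y h1 c.2 h' be.2))
     * prow x0 q h' (fun bs => k (be.1 :: be.2 :: bs)) post).
    rewrite !big_bool !sum_bool2 !big_bool /=; ring.
  rewrite (eq_bigr _ (fun h' _ => eq_bigr _ (fun be _ => congr1 ( *%R^~ _)
    (yang_baxter_columns s x0 x y h b h' be)))).
  transitivity (\sum_(h' : bool) \sum_(c : bool * bool) \sum_(h1 : bool)
     poly_bulk s x0 y h b.1 h1 c.1 * poly_bulk s x0 x h1 b.2 h' c.2 *
     prow x0 q h' (fun bs => k' (c.1 :: c.2 :: bs)) post).
    apply: eq_bigr => h' _.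
    under eq_bigr => be _ do rewrite mulr_suml.
    rewrite exchange_big; apply: eq_bigr => c _.
    under eq_bigr => be _ do rewrite mulr_suml.
    rewrite exchange_big; apply: eq_bigr => h1 _.
    under eq_bigr => be _ do rewrite -mulrA.
    under eq_bigr => be _ do rewrite -grid_rowZ.
    rewrite -mulr_sumr -grid_row_sum; congr (_ * _); apply: eq_grid_row => bs.
    exact: (kk' [::]).
  rewrite !big_bool !sum_bool2 !big_bool /=; ring.
under eq_bigr => c _ do rewrite mulr_sumr.
rewrite exchange_big; apply: eq_bigr => h' _.
under eq_bigr => c _ do rewrite mulr_sumr.
rewrite exchange_big; apply: eq_bigr => be _.
under eq_bigr => c _ do rewrite mulrCA.
rewrite -mulr_sumr; congr (_ * _); apply: IH => // pre' c bs sz'.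
by apply: (kk' (be :: pre')); rewrite /= sz'.
Qed.

(** Here the crossing moves to the right, where both lines leave with bit
    [false], so that it is absorbed as a scalar. *)
Lemma two_rows_exchange x y q hg (k : seq bool -> A) al :
  \sum_(c : bool * bool) crossing s true x y hg c *
     prow x q c.1 (prow y q c.2 k) al
  = (1 + w * y + x * y) * prow y q hg.1 (prow x q hg.2 k) al.
Proof.
elim: q hg k al => [|z q IH] hg k [|b al];
  try by rewrite sum_bool2; case: hg => [[] []] /=;
         rewrite ?(mulr0, addr0, add0r, mul0r).
have rrE u v h g : prow u (z :: q) h (prow v (z :: q) g k) (b :: al)
    = \sum_(hg' : bool * bool) \sum_(be : bool) \sum_(e : bool)
       poly_bulk s u z h b hg'.1 e * poly_bulk s v z g e hg'.2 be
       * prow u q hg'.1 (prow v q hg'.2 (fun bs => k (be :: bs))) al.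
  rewrite -(pair_bigA _ (fun h' g' => \sum_(be : bool) \sum_(e : bool)
     poly_bulk s u z h b h' e * poly_bulk s v z g e g' be
       * prow u q h' (prow v q g' (fun bs => k (be :: bs))) al)) /=.
  apply: eq_bigr => h' _.
  rewrite [RHS](eq_bigr _ (fun g' _ => exchange_big _ _ _ _ _ _)) /=.
  rewrite [RHS]exchange_big; apply: eq_bigr => e _ /=.
  rewrite grid_row_sum mulr_sumr; apply: eq_bigr => g' _.
  rewrite grid_row_sum mulr_sumr; apply: eq_bigr => be _.
  by rewrite grid_rowZ mulrA.
under eq_bigr => c _ do rewrite rrE.
transitivity (\sum_(hg' : bool * bool) \sum_(be : bool)
   (\sum_(c : bool * bool) \sum_(g : bool)
     crossing s true x y hg c *
       (poly_bulk s x z c.1 b hg'.1 g * poly_bulk s y z c.2 g hg'.2 be))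
    * prow x q hg'.1 (prow y q hg'.2 (fun bs => k (be :: bs))) al).
  under eq_bigr => c _ do rewrite mulr_sumr.
  rewrite exchange_big; apply: eq_bigr => hg' _.
  under eq_bigr => c _ do rewrite mulr_sumr.
  rewrite exchange_big; apply: eq_bigr => be _.
  rewrite mulr_suml; apply: eq_bigr => c _.
  rewrite mulr_suml mulr_sumr; apply: eq_bigr => e _.
  by rewrite !mulrA.
rewrite (eq_bigr _ (fun hg' _ => eq_bigr _ (fun be _ => congr1 ( *%R^~ _)
    (yang_baxter_rows s x y z hg b hg' be)))).
rewrite rrE mulr_sumr.
under eq_bigr => hg' _.
  under eq_bigr => be _.
    rewrite mulr_suml.
    under eq_bigr => c _ do rewrite mulr_suml.
    over.
  rewrite exchange_big.
  over.
rewrite exchange_big /=; apply: eq_bigr => c _.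
rewrite exchange_big mulr_sumr; apply: eq_bigr => be _ /=.
rewrite exchange_big mulr_sumr; apply: eq_bigr => e _ /=.
under eq_bigr => hg' _ do rewrite -mulrA.
by rewrite -mulr_sumr IH mulrCA.
Qed.

Lemma grid_corner x y q post c :
   pgrid s (x :: y :: q) (c.1 :: c.2 :: post)
    = \sum_d corner s x y c d * prow x q d.1 (prow y q d.2 (pgrid s q)) post.
Proof.
rewrite -(pair_bigA _ (fun h' g => corner s x y c (h', g)
   * prow x q h' (prow y q g (pgrid s q)) post)) /=.
rewrite /corner /=.
transitivity (\sum_(h : bool) \sum_(h' : bool) \sum_(be : bool) \sum_(g : bool)
  poly_left s x c.1 h * poly_bulk s x y h c.2 h' be * poly_left s y be g
  * prow x q h' (prow y q g (pgrid s q)) post).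
  apply: eq_bigr => h _; rewrite mulr_sumr; apply: eq_bigr => h' _.
  rewrite mulr_sumr; apply: eq_bigr => be _.
  rewrite grid_row_sum !mulr_sumr; apply: eq_bigr => g _.
  by rewrite grid_rowZ !mulrA.
rewrite exchange_big; apply: eq_bigr => h' _ /=.
under eq_bigr => h _ do rewrite exchange_big.
rewrite exchange_big; apply: eq_bigr => g _ /=.
rewrite mulr_suml; apply: eq_bigr => h _.
by rewrite mulr_suml.
Qed.

(** The crossing enters above the columns of [x] and [y], is pushed down the
    [size p] rows above their corner, reflected there, and pushed out on the
    right. *)
Lemma grid_exchange x y p q pre b post : size pre = size p ->
  \sum_(c : bool * bool) crossing s false x y b c *
     pgrid s (p ++ x :: y :: q) (pre ++ c.1 :: c.2 :: post)
  = (1 + w * y + x * y) * pgrid s (p ++ y :: x :: q) (pre ++ b.1 :: b.2 :: post).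
Proof.
elim: p pre b post => [|x0 p IH] [|a pre] b post sz //.
  rewrite !cat0s grid_corner.
  under eq_bigr => c _ do rewrite !cat0s grid_corner mulr_sumr.
  rewrite exchange_big /=.
  under eq_bigr => d _.
    under eq_bigr => c _ do rewrite mulrA.
    rewrite -mulr_suml reflection mulr_suml.
    over.
  rewrite exchange_big mulr_sumr; apply: eq_bigr => c _ /=.
  under eq_bigr => d _ do rewrite -mulrA.
  by rewrite -mulr_sumr two_rows_exchange mulrCA.
case: sz => sz /=.
under eq_bigr => c _ do rewrite mulr_sumr.
rewrite exchange_big mulr_sumr; apply: eq_bigr => h _ /=.
under eq_bigr => c _ do rewrite mulrCA.
rewrite -mulr_sumr mulrCA; congr (_ * _).
rewrite -grid_rowZ.
by apply: grid_row_exchange => // pre' c bs sz'; exact: IH.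
Qed.
End Exchange.

(** * The polynomial partition function: symmetry, degree, special values *)

Definition Zpol (A : comNzRingType) (s : A) (xs : seq A) : A :=
  pgrid s xs (nseq (size xs) false).

Section Morphism.
Variables (A B : comNzRingType) (f : {rmorphism A -> B}).
Variables (T T' : Type) (g : T -> T').
Variables (K : T -> bool -> bool -> A) (W : T -> T -> bool -> bool -> bool -> bool -> A).
Variables (K' : T' -> bool -> bool -> B) (W' : T' -> T' -> bool -> bool -> bool -> bool -> B).
Hypothesis fK : forall x a h, f (K x a h) = K' (g x) a h.
Hypothesis fW : forall x y h b h' be, f (W x y h b h' be) = W' (g x) (g y) h b h' be.

Lemma rmorph_grid_row x ys h k k' al : (forall bs, f (k bs) = k' bs) ->
  f (grid_row W x ys h k al) = grid_row W' (g x) (map g ys) h k' al.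
Proof.
elim: ys h k k' al => [|y ys IH] h k k' [|b al] fk /=;
  try by case: h; rewrite ?rmorph0.
rewrite rmorph_sum; apply: eq_bigr => h' _; rewrite rmorph_sum.
by apply: eq_bigr => be _; rewrite rmorphM fW; congr (_ * _); apply: IH.
Qed.

Lemma rmorph_grid xs al : f (grid K W xs al) = grid K' W' (map g xs) al.
Proof.
elim: xs al => [|x xs IH] [|a al] /=; rewrite ?rmorph1 //.
rewrite rmorph_sum; apply: eq_bigr => h _; rewrite rmorphM fK.
by congr (_ * _); apply: rmorph_grid_row.
Qed.

End Morphism.

Lemma rmorph_pgrid (A B : comNzRingType) (f : {rmorphism A -> B}) s xs al :
  f (pgrid s xs al) = pgrid (f s) (map f xs) al.
Proof.
apply: rmorph_grid => [x a h|x y h b h' be].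
  by case: a h => [] [] /=; rewrite /tau2
    ?(rmorph0, rmorph1, rmorphN, rmorphD, rmorphB, rmorphM, rmorphXn, rmorph_nat).
by case: h b h' be => [] [] [] [] /=; rewrite /tau2 /aweight
  ?(rmorph0, rmorph1, rmorphN, rmorphD, rmorphB, rmorphM, rmorphXn, rmorph_nat).
Qed.

Lemma rmorph_Zpol (A B : comNzRingType) (f : {rmorphism A -> B}) s xs :
  f (Zpol s xs) = Zpol (f s) (map f xs).
Proof. by rewrite /Zpol size_map rmorph_pgrid. Qed.

Section Symmetry.
Variables (A : idomainType).
Implicit Types (s x y : A).
Local Notation w s := (s ^+ 2 - 2%:R).

Lemma Zpol_swap_reg s x y p q : 1 + w s * y + x * y != 0 ->
  Zpol s (p ++ x :: y :: q) = Zpol s (p ++ y :: x :: q).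
Proof.
move=> nz; apply: (mulfI nz); rewrite /Zpol !size_cat /= !nseqD /=.
rewrite -(@grid_exchange _ s x y p q _ (false, false)) ?size_nseq //.
by rewrite sum_bool2 /= !mul0r !add0r.
Qed.

End Symmetry.

(** The scalar 1 + w y + x y of the exchange relation may vanish.  Translating
    both parameters by an indeterminate makes it a monic quadratic polynomial,
    which can be cancelled; then the indeterminate is set to 0. *)
Lemma Zpol_swap (A : idomainType) (s x y : A) p q :
  Zpol s (p ++ x :: y :: q) = Zpol s (p ++ y :: x :: q).
Proof.
pose P (l : seq A) := map polyC l; pose X := 'X : {poly A}.
have E : Zpol s%:P (P p ++ (x%:P + X) :: (y%:P + X) :: P q)
       = Zpol s%:P (P p ++ (y%:P + X) :: (x%:P + X) :: P q).
  apply: Zpol_swap_reg; apply/eqP => /(congr1 (fun r : {poly A} => r`_2)).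
  have -> : 1 + ((s%:P) ^+ 2 - 2%:R) * (y%:P + X) + (x%:P + X) * (y%:P + X)
     = (1 + (s ^+ 2 - 2%:R) * y + x * y)%:P + ((s ^+ 2 - 2%:R) + x + y)%:P * 'X + 'X^2.
    by rewrite !(rmorphD, rmorphM, rmorphN, rmorphXn, rmorph_nat, rmorph1) /= /X; ring.
  rewrite !coefD coefXn coefC coefCM coefX /= mulr0 !add0r coef0 => /eqP.
  by rewrite oner_eq0.
have PE l : map (horner_eval 0) (P l) = l.
  by rewrite -map_comp map_id_in // => z _; rewrite /= /horner_eval hornerC.
move/(congr1 (horner_eval 0)): E; rewrite !rmorph_Zpol !map_cat /= !PE.
by rewrite /horner_eval !hornerE.
Qed.

Lemma perm_Zpol (A : idomainType) (s : A) xs ys :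
  perm_eq xs ys -> Zpol s xs = Zpol s ys.
Proof.
rewrite -[xs]cat0s -[ys]cat0s perm_cat2l.
elim: xs ys [::] => [|x xs IH] ys p; first by rewrite perm_sym => /perm_nilP ->.
move=> pxs; have xys : x \in ys by rewrite -(perm_mem pxs) mem_head.
case/splitPr: xys pxs => l1 l2 pxs.
have {}pxs : perm_eq xs (l1 ++ l2).
  by rewrite -(perm_cons x); apply: perm_trans pxs _; rewrite perm_sym -cat1s perm_catCA.
transitivity (Zpol s (p ++ x :: (l1 ++ l2))).
  by rewrite -!cat_rcons; apply: IH.
elim: l1 p {pxs IH} => [|z l1 IH] p //=.
by rewrite Zpol_swap -cat_rcons IH cat_rcons.
Qed.

Section Specialisations.
Variables (A : comNzRingType) (s : A).
Implicit Types (x y z : A) (ys : seq A).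
Local Notation prow := (grid_row (poly_bulk s)).

(** A bulk vertex preserves the number of [true] bits, so a row that meets only
    [false] stays [false]. *)
Lemma grid_row_false x ys k :
  prow x ys false k (nseq (size ys) false)
  = \prod_(y <- ys) (1 - x * y) * k (nseq (size ys) false).
Proof.
elim: ys k => [|y ys IH] k /=; first by rewrite big_nil mul1r.
by rewrite !big_bool /= !mul0r !add0r IH big_cons mulrA.
Qed.

Lemma Zpol_cons0 ys : Zpol s (0 :: ys) = Zpol s ys.
Proof.
rewrite /Zpol /= big_bool /= mulr0 mul0r add0r mul1r grid_row_false.
by rewrite big1 ?mul1r // => y _; rewrite mul0r subr0.
Qed.

(** At the last column the row must leave with bit [false]; a [true] on top of
    that column forces the vertex, and the column keeps its bit. *)
Lemma grid_row_last_true x z ys h k al : size al = size ys ->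
  prow x (rcons ys z) h k (rcons al true)
  = aweight s x z * prow x ys h (fun bs => k (rcons bs true)) al.
Proof.
elim: ys h k al => [|y ys IH] h k [|b al] //= => [_|[sz]].
  by rewrite !big_bool; case: h; rewrite /= ?(mulr0, mul0r, addr0, add0r).
rewrite mulr_sumr; apply: eq_bigr => h' _; rewrite mulr_sumr.
by apply: eq_bigr => be _; rewrite mulrCA IH.
Qed.

Lemma grid_last_true z ys al : size al = size ys ->
  pgrid s (rcons ys z) (rcons al true)
  = \prod_(y <- ys) aweight s y z * (s * z) * pgrid s ys al.
Proof.
elim: ys al => [|y ys IH] [|b al] //= => [_|[sz]].
  by rewrite big_bool big_nil /= mulr0 add0r mulr1 mul1r mulr1.
rewrite big_cons mulr_sumr; apply: eq_bigr => h _.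
rewrite grid_row_last_true // (eq_grid_row_size _ _ _ sz (fun bs => IH bs)) grid_rowZ mulrCA.
by ring.
Qed.

Lemma grid_row_false_inv x z ys k : x * z = 1 ->
  prow x (rcons ys z) false k (nseq (size ys).+1 false) = 0.
Proof.
move=> xz; rewrite -(size_rcons ys z) grid_row_false -cats1 big_cat big_seq1 /=.
by rewrite xz subrr mulr0 mul0r.
Qed.

Lemma grid_row_true_inv x z ys k : x * z = 1 ->
  prow x (rcons ys z) true k (nseq (size ys).+1 false)
  = \prod_(y <- ys) aweight s x y * k (rcons (nseq (size ys) false) true).
Proof.
move=> xz; elim: ys k => [|y ys IH] k /=.
  by rewrite !big_bool big_nil /= !(mul0r, mulr0, add0r, addr0).
rewrite !big_bool /= -![false :: nseq _ _]/(nseq (size ys).+1 false).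
by rewrite grid_row_false_inv // !(mul0r, mulr0, addr0, add0r) big_cons -mulrA IH.
Qed.

(** The weight 1 - x z vanishes, so the first row has to arrive at the last column
    with bit [true] and to exchange it there.  This forces every vertex of the
    first row, then every vertex of the last column, and a lattice without the two
    lines is left. *)
Lemma Zpol_inv_last x z ys : x * z = 1 ->
  Zpol s (x :: rcons ys z)
  = s ^+ 2 * \prod_(y <- ys) (aweight s x y * aweight s z y) * Zpol s ys.
Proof.
move=> xz; rewrite /Zpol /= big_bool /= size_rcons.
rewrite grid_row_true_inv // grid_last_true ?size_nseq //.
rewrite grid_row_false_inv // mulr0 addr0 big_split /=.
have -> : \prod_(y <- ys) aweight s z y = \prod_(y <- ys) aweight s y z.
  by apply: eq_bigr => y _; rewrite /aweight; ring.
set P := \prod_(_ <- _) _; set Q := \prod_(_ <- _) _; set G := grid _ _ _ _.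
by transitivity (s ^+ 2 * (x * z) * (Q * P) * G); [ring | rewrite xz mulr1].
Qed.

End Specialisations.

Lemma Zpol_inv (A : idomainType) (s x z : A) ys : x * z = 1 ->
  Zpol s (x :: z :: ys)
  = s ^+ 2 * \prod_(y <- ys) (aweight s x y * aweight s z y) * Zpol s ys.
Proof.
move=> xz; rewrite -Zpol_inv_last //; apply: perm_Zpol.
by rewrite perm_cons perm_sym perm_rcons.
Qed.

Section Degree.
Variables (F : fieldType) (s : F).
Implicit Types (x y z : F) (ys : seq F).
Local Notation PC := (map polyC).

(** [size] is the degree plus one; the bounds are put so that degrees add up. *)
Lemma size_mul_le (p q : {poly F}) a b :
  (size p <= a.+1)%N -> (size q <= b)%N -> (size (p * q)%R <= a + b)%N.
Proof.
move=> pa qb; apply: leq_trans (size_polyMleq _ _) _.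
by rewrite -subn1 leq_subLR add1n -addSn leq_add.
Qed.

Lemma size_prod_le (p : F -> {poly F}) ys a :
  {in ys, forall y, size (p y) <= a.+1}%N ->
  (size (\prod_(y <- ys) p y)%R <= (a * size ys).+1)%N.
Proof.
elim: ys => [|y ys IH] le; first by rewrite big_nil size_poly1.
rewrite big_cons /= mulnS -addnS; apply: size_mul_le; first by apply/le/mem_head.
by apply: IH => z zy; apply: le; rewrite inE zy orbT.
Qed.

Lemma size_affine (a b : F) : (size (a%:P + b%:P * 'X)%R <= 2)%N.
Proof.
apply: leq_trans (size_polyD _ _) _; rewrite geq_max.
rewrite (leq_trans (size_polyC_leq1 _)) // mulrC.
by rewrite (@size_mul_le _ _ 1 1) ?size_polyX ?size_polyC_leq1.
Qed.

Lemma size_row_const ys h (k : seq bool -> {poly F}) : (forall bs, size (k bs) <= 1)%N ->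
  (size (grid_row (poly_bulk s%:P) 'X (PC ys) h k (nseq (size ys) false))
     <= size ys + ~~ h)%N.
Proof.
elim: ys h k => [|y ys IH] h k k1 /=; first by case: h; rewrite ?size_poly0.
rewrite !big_bool; case: h => /=; rewrite !(mul0r, add0r, addr0) ?mul1r.
  apply: leq_trans (size_polyD _ _) _; rewrite geq_max addn0; apply/andP; split.
    have -> : aweight s%:P 'X y%:P = y%:P + (1 + (s ^+ 2 - 2%:R) * y)%:P * 'X.
      rewrite /aweight !(rmorphD, rmorphM, rmorphN, rmorphXn, rmorph_nat, rmorph1) /=.
      by ring.
    rewrite -[(size ys).+1]add1n; apply: size_mul_le; first exact: size_affine.
    by apply: leq_trans (IH true _ _) _; rewrite ?addn0.
  by apply: leq_trans (IH false _ _) _; rewrite ?addn1.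
have -> : 1 - 'X * y%:P = 1%:P + (- y)%:P * 'X.
  by rewrite rmorphN rmorph1 /=; ring.
rewrite addSn -[_.+1]add1n; apply: size_mul_le; first exact: size_affine.
by apply: leq_trans (IH false _ _) _; rewrite ?addn1.
Qed.

(** Only the first row contains the first parameter.  Its straight vertices have
    degree 1; if the boundary vertex has degree 1 too, then the row must turn
    somewhere, at a vertex of degree 0. *)
Lemma size_Zpol ys :
  (size (Zpol s%:P ('X :: PC ys)) <= (size ys).+1)%N.
Proof.
rewrite /Zpol /= big_bool size_map /= mul1r.
have k1 bs : (size (pgrid s%:P (PC ys) bs) <= 1)%N.
  by rewrite -rmorph_pgrid size_polyC_leq1.
apply: leq_trans (size_polyD _ _) _; rewrite geq_max; apply/andP; split.
  rewrite -[(size ys).+1]add1n; apply: size_mul_le.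
    by rewrite -[_ * _]add0r -polyC0 size_affine.
  by apply: leq_trans (size_row_const _ true _) _; rewrite ?addn0.
by apply: leq_trans (size_row_const _ false _) _; rewrite ?addn1.
Qed.

Lemma horner_Zpol x ys :
  (Zpol s%:P ('X :: PC ys)).[x] = Zpol s (x :: ys).
Proof.
rewrite -[LHS]/(horner_eval x _) rmorph_Zpol /= /horner_eval hornerC hornerX.
rewrite -map_comp map_id_in // => z _; exact: hornerC.
Qed.

End Degree.

(** * The recursion for the partition function *)

Lemma Zpol_nil (A : comNzRingType) (s : A) : Zpol s [::] = 1.
Proof. by []. Qed.
Lemma Zpol_one (A : comNzRingType) (s x : A) : Zpol s [:: x] = 1.
Proof. by rewrite /Zpol /= big_bool /= mulr0 mul1r add0r. Qed.

Arguments Zpol : simpl never.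

Section Interpolation.
Variables (F : fieldType) (s : F).
Implicit Types (x y z : F) (xs ys : seq F).
Local Notation PC := (map polyC).
Local Notation w := (s ^+ 2 - 2%:R).

(** These conditions make the interpolation nodes 0, 1, [ys] and the inverses of
    [ys] distinct. *)
Definition generic ys : Prop :=
  [/\ uniq ys, 0 \notin ys, 1 \notin ys & {in ys &, forall x y, x * y != 1}].

Lemma generic_sub xs ys : {subset ys <= xs} -> uniq ys -> generic xs -> generic ys.
Proof.
move=> sub uys [_ n0 n1 n2]; split=> //; try by apply/negP => /sub; apply/negP.
by move=> x y /sub ? /sub ?; apply: n2.
Qed.

Lemma generic_cons x ys : generic (x :: ys) -> generic ys.
Proof.
move=> g; apply: (generic_sub _ _ g) => [y|]; first by rewrite inE orbC => ->.
by case: g => /= /andP[].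
Qed.

Lemma generic_rem x ys : generic ys -> generic (rem x ys).
Proof.
move=> g; apply: (generic_sub _ _ g); first exact: mem_rem.
by apply: rem_uniq; case: g.
Qed.

Lemma generic_neq0 ys y : generic ys -> y \in ys -> y != 0.
Proof. by case=> _ n0 _ _ yys; apply: contraNneq n0 => <-. Qed.

Lemma generic_roots ys : generic ys -> uniq (0 :: 1 :: ys ++ map GRing.inv ys).
Proof.
case=> u n0 n1 n2; rewrite /= inE negb_or eq_sym oner_eq0 !mem_cat !negb_or n0 n1.
rewrite cat_uniq u map_inj_uniq ?u; last exact: invr_inj.
rewrite andbT /=; apply/and3P; split.
- by apply: contraNN n0 => /mapP[y yys] /eqP; rewrite eq_sym invr_eq0 => /eqP <-.
- apply: contraNN n1 => /mapP[y yys] /(congr1 GRing.inv); rewrite invr1 invrK.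
  by move=> ->.
apply/hasPn => _ /mapP[y yys ->]; apply/negP => yV.
have y0 : y != 0 by apply: contraNneq n0 => <-.
by have := n2 _ _ yys yV; rewrite mulfV ?eqxx.
Qed.

Lemma horner_eq0_roots (p : {poly F}) rs x :
  uniq rs -> {in rs, forall r, p.[r] = 0} -> (size p <= size rs)%N -> p.[x] = 0.
Proof.
move=> u r0 le; rewrite (roots_geq_poly_eq0 _ u le) ?horner0 //.
by apply/allP => r /r0 /eqP.
Qed.

(** Interpolation in the first variable of [xs] at 0, 1 and the inverses of the
    other variables; each value reduces to fewer variables. *)
Lemma Zpol_cons1 xs : generic xs ->
  Zpol s (1 :: xs) = \prod_(x <- xs) (1 + (w + 1) * x) * Zpol s xs.
Proof.
have [n] := ubnP (size xs); elim: n xs => // n IH [|x ys] /= ltn g.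
  by rewrite big_nil mul1r Zpol_nil Zpol_one.
have gys := generic_cons g.
have IHys := IH ys ltn gys.
pose p := Zpol s%:P ('X :: PC (1 :: ys)) - (\prod_(y <- ys) (1 + (w + 1) * y))%:P *
  ((1%:P + (w + 1)%:P * 'X) * Zpol s%:P ('X :: PC ys)).
have pE z : p.[z] = Zpol s (z :: 1 :: ys) - \prod_(y <- ys) (1 + (w + 1) * y) *
     ((1 + (w + 1) * z) * Zpol s (z :: ys)).
  by rewrite /p hornerD hornerN !hornerM !hornerD !hornerM !horner_Zpol !hornerC !hornerX.
suff : p.[x] = 0.
  rewrite pE => /eqP; rewrite subr_eq0 => /eqP E.
  rewrite -[1 :: _]cat0s Zpol_swap /= E big_cons; ring.
apply: (@horner_eq0_roots _ (0 :: 1 :: map GRing.inv ys)).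
- have := generic_roots gys; apply: subseq_uniq.
  exact: (cat_subseq (subseq_refl [:: 0; 1]) (suffix_subseq ys _)).
- move=> r; rewrite !inE pE => /or3P[/eqP -> | /eqP -> | /mapP[y yys ->]].
  + by rewrite !Zpol_cons0 IHys; ring.
  + rewrite Zpol_inv ?mulr1 // big_split /= IHys.
    have -> : \prod_(y <- ys) aweight s 1 y = \prod_(y <- ys) (1 + (w + 1) * y).
      by apply: eq_bigr => y _; rewrite /aweight; ring.
    by ring.
  have y0 := generic_neq0 gys yys; have py := perm_to_rem yys.
  rewrite (@perm_Zpol _ s (y^-1 :: ys) (y^-1 :: y :: rem y ys)) ?perm_cons //.
  rewrite (@perm_Zpol _ s (y^-1 :: 1 :: ys) (y^-1 :: y :: 1 :: rem y ys)); last first.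
    rewrite perm_cons; apply: (@perm_trans _ (1 :: y :: rem y ys)).
      by rewrite perm_cons.
    by rewrite (perm_catCA [:: 1] [:: y]).
  rewrite !Zpol_inv ?mulVf // (perm_big _ py) /= !big_cons.
  rewrite IH; last exact: generic_rem.
    by rewrite /aweight; field.
  by apply: leq_ltn_trans (ltn : (size ys < n)%N); rewrite size_rem // leq_pred.
rewrite /= size_map; apply: leq_trans (size_polyD _ _) _; rewrite size_polyN geq_max.
apply/andP; split; first exact: size_Zpol.
rewrite -[(size ys).+2]add0n; apply: size_mul_le; first exact: size_polyC_leq1.
rewrite -[(size ys).+2]add1n; apply: size_mul_le; first exact: size_affine.
exact: size_Zpol.
Qed.

(** The factor x_j (1 + w x_i + x_i x_j) / (x_j - x_i) of the recursion for the
    symmetrised sum, times the 1 - x_i x_j lost when x_i is removed from the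
    denominator. *)
Definition rec_coef x y := y * (1 - x * y) * (1 + w * x + x * y) / (y - x).

Lemma prod_sub_rec_coef x ys : x \notin ys ->
  \prod_(y <- ys) (y - x) * \prod_(y <- ys) rec_coef x y
  = \prod_(y <- ys) (y * (1 - x * y) * (1 + w * x + x * y)).
Proof.
move=> xys; rewrite -big_split; apply: eq_big_seq => y yys /=.
rewrite /rec_coef mulrC divfK // subr_eq0; by apply: contraNneq xys => <-.
Qed.

Lemma prod_sub_eq0 x ys : x \in ys -> \prod_(y <- ys) (y - x) = 0.
Proof. by move=> xys; rewrite (perm_big _ (perm_to_rem xys)) /= big_cons subrr mul0r. Qed.

(** In the first variable, cleared of the denominators y - x, the difference of
    both sides is [T1 - T2 + T3] below.  At 0 the terms cancel directly; at 1
    and at the inverse of a variable the recursion for fewer variables applies;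
    at another variable symmetry makes two terms cancel. *)
Lemma Zpol_recursion xs : generic xs ->
  (1 - \prod_(x <- xs) x) * Zpol s xs =
  \sum_(x <- xs) (1 - x) * \prod_(y <- rem x xs) rec_coef x y * Zpol s (rem x xs).
Proof.
have [n] := ubnP (size xs); elim: n xs => // n IH [|x ys] /= ltn g.
  by rewrite !big_nil subrr mul0r.
have gys := generic_cons g.
have IHys := IH ys ltn gys.
have uys : uniq ys by case: gys.
(* T1 is the left-hand side; T2 is the term that removes the variable itself
   and T3 the sum of the others, whose factor y - X has the opposite sign. *)
pose T1 := (1%:P + (- \prod_(y <- ys) y)%:P * 'X) *
  (\prod_(y <- ys) (y%:P + (- 1)%:P * 'X) * Zpol s%:P ('X :: PC ys)).
pose T2 := (1%:P + (- 1)%:P * 'X) * (\prod_(y <- ys) ((y%:P + (- y ^+ 2)%:P * 'X)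
   * (1%:P + (w + y)%:P * 'X)) * (Zpol s ys)%:P).
pose T3 := \sum_(y <- ys) ((1 - y) * \prod_(z <- rem y ys) rec_coef y z)%:P
   * ((0%:P + 1%:P * 'X) * ((1%:P + (- y)%:P * 'X) * (((1 + w * y)%:P + y%:P * 'X)
   * (\prod_(z <- rem y ys) (z%:P + (- 1)%:P * 'X) * Zpol s%:P ('X :: PC (rem y ys)))))).
have subE l z : (\prod_(y <- l) (y%:P + (- 1)%:P * 'X)).[z] = \prod_(y <- l) (y - z).
  rewrite horner_prod; apply: eq_bigr => y _.
  by rewrite hornerD hornerM !hornerC hornerX mulN1r.
have T1E z : T1.[z] = (1 - z * \prod_(y <- ys) y) * \prod_(y <- ys) (y - z)
     * Zpol s (z :: ys).
  rewrite /T1 !hornerM subE horner_Zpol hornerD hornerM !hornerC hornerX.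
  by ring.
have T2E z : T2.[z] = (1 - z) * \prod_(y <- ys) (y * (1 - z * y) * (1 + w * z + z * y))
    * Zpol s ys.
  rewrite /T2 !hornerM horner_prod hornerD hornerM !hornerC hornerX mulrA mulN1r.
  congr (_ * _ * _); apply: eq_bigr => y _.
  by rewrite hornerM !hornerD !hornerM !hornerC hornerX; ring.
have T3E z : T3.[z] = \sum_(y <- ys) (1 - y) * \prod_(t <- rem y ys) rec_coef y t
   * (z * (1 - y * z) * (1 + w * y + y * z)) * \prod_(t <- rem y ys) (t - z)
   * Zpol s (z :: rem y ys).
  rewrite /T3 horner_sum; apply: eq_bigr => y _.
  rewrite !hornerM subE horner_Zpol !hornerD !hornerM !hornerC !hornerX.
  by ring.
suff : (T1 - T2 + T3).[x] = 0.
  have xys : x \notin ys by case: g => /= /andP[].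
  have D0 : \prod_(y <- ys) (y - x) != 0.
    rewrite prodf_seq_neq0; apply/allP => y yys /=; rewrite subr_eq0.
    by apply: contraNneq xys => <-.
  rewrite hornerD hornerD hornerN T1E T2E T3E -prod_sub_rec_coef // => E.
  apply: (mulfI D0); rewrite !big_cons eqxx mulrDr.
  set D := \prod_(y <- ys) (y - x) in D0 E *.
  have -> : D * (\sum_(y <- ys) (1 - y) * \prod_(t <- if x == y then ys else x :: rem y ys)
       rec_coef y t * Zpol s (if x == y then ys else x :: rem y ys))
     = - \sum_(y <- ys) (1 - y) * \prod_(t <- rem y ys) rec_coef y t
         * (x * (1 - y * x) * (1 + w * y + y * x)) * \prod_(t <- rem y ys) (t - x)
         * Zpol s (x :: rem y ys).
    rewrite mulr_sumr -sumrN; apply: eq_big_seq => y yys.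
    have xy : x != y by apply: contraNneq xys => ->.
    rewrite (negbTE xy) /D (perm_big _ (perm_to_rem yys)) /= !big_cons /rec_coef.
    set P1 := \prod_(_ <- _) _; set P2 := \prod_(_ <- _) _.
    by field; rewrite subr_eq0.
  apply/eqP; rewrite -subr_eq0 -[X in _ == X]E; apply/eqP; ring.
apply: (@horner_eq0_roots _ (0 :: 1 :: ys ++ map GRing.inv ys)).
- exact: generic_roots.
- move=> r; rewrite !inE mem_cat hornerD hornerD hornerN T1E T2E T3E.
  case/or4P=> [/eqP -> | /eqP -> | yys | /mapP[y yys ->]].
  + rewrite Zpol_cons0 [X in _ + X]big1 => [|y _]; last by rewrite !(mul0r, mulr0).
    rewrite [X in _ - (1 - 0) * X * _ + _](_ : _ = \prod_(y <- ys) (y - 0)); last first.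
      by apply: eq_bigr => y _; ring.
    by ring.
  + rewrite subrr !mul0r subr0 mul1r Zpol_cons1 //.
    set P := \prod_(y <- ys) (y - 1); set Q := \prod_(y <- ys) (1 + _).
    transitivity (P * Q * ((1 - \prod_(y <- ys) y) * Zpol s ys) +
       \sum_(y <- ys) (1 - y) * \prod_(t <- rem y ys) rec_coef y t *
     (1 * (1 - y * 1) * (1 + w * y + y * 1)) * \prod_(t <- rem y ys) (t - 1) *
     Zpol s (1 :: rem y ys)); first by ring.
    rewrite IHys mulr_sumr -big_split big1_seq //= => y yys.
    rewrite Zpol_cons1; last exact: generic_rem.
    rewrite /P /Q !(perm_big _ (perm_to_rem yys)) /= !big_cons.
    by ring.
  + rewrite prod_sub_eq0 // mulr0 mul0r sub0r.
    rewrite [X in _ + X](perm_big _ (perm_to_rem yys)) /= big_cons.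
    rewrite [X in _ + (_ + X)]big1_seq ?addr0 => [|t /=]; last first.
      rewrite mem_rem_uniq // inE => /andP[tr tys].
      by rewrite (@prod_sub_eq0 r) ?mulr0 ?mul0r // mem_rem_uniq // inE eq_sym tr.
    have rr : r \notin rem r ys by rewrite mem_rem_uniq // inE eqxx.
    rewrite (perm_Zpol s (perm_to_rem yys)).
    rewrite (perm_big _ (perm_to_rem yys)) /= big_cons -(prod_sub_rec_coef rr).
    by ring.
  have y0 := generic_neq0 gys yys; have py := perm_to_rem yys.
  rewrite [X in _ - X + _](_ : _ = 0) ?subr0; last first.
    by rewrite (perm_big _ py) /= big_cons mulVf // subrr !(mulr0, mul0r).
  rewrite (perm_big _ py) (perm_big _ py) (perm_big _ py) /= !big_cons mulfV // subrr.
  rewrite !(mulr0, mul0r) add0r mulKf //.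
  rewrite (@perm_Zpol _ s (y^-1 :: ys) (y^-1 :: y :: rem y ys)) ?perm_cons //.
  rewrite Zpol_inv ?mulVf //.
  set R := rem y ys.
  have gR : generic R by apply: generic_rem.
  have ltR : (size R < n)%N.
    by apply: leq_ltn_trans (ltn : (size ys < n)%N); rewrite size_rem // leq_pred.
  set P := \prod_(t <- R) (t - y^-1); set Q := \prod_(t <- R) (_ * _).
  transitivity ((y - y^-1) * P * s ^+ 2 * Q * ((1 - \prod_(t <- R) t) * Zpol s R) +
    \sum_(j <- R)
     (1 - j) * \prod_(t <- rem j ys) rec_coef j t *
     (y^-1 * (1 - j * y^-1) * (1 + w * j + j * y^-1)) *
     \prod_(t <- rem j ys) (t - y^-1) * Zpol s (y^-1 :: rem j ys)).
    by ring.
  rewrite IH // mulr_sumr -big_split big1_seq //= => t tR.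
  have tys : t \in ys by apply: mem_rem tR.
  have yt : y != t.
    by move: tR; rewrite mem_rem_uniq // inE eq_sym => /andP[].
  have pt : perm_eq (rem t ys) (y :: rem t R).
    rewrite -(perm_cons t); apply: (@perm_trans _ ys).
      by rewrite perm_sym perm_to_rem.
    apply: (perm_trans py); rewrite -/R.
    apply: (@perm_trans _ (y :: t :: rem t R)).
      by rewrite perm_cons perm_to_rem.
    by rewrite (perm_catCA [:: y] [:: t]).
  rewrite (@perm_Zpol _ s (y^-1 :: rem t ys) (y^-1 :: y :: rem t R)) ?perm_cons //.
  rewrite Zpol_inv ?mulVf // !(perm_big _ pt) /= !big_cons.
  rewrite /P /Q !(perm_big _ (perm_to_rem tR)) /= !big_cons.
  rewrite /rec_coef /aweight.
  set A1 := \prod_(_ <- _) _; set A2 := \prod_(_ <- _) _; set A3 := \prod_(_ <- _) _.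
  by field; rewrite y0 subr_eq0.
rewrite /= size_cat size_map.
have le1 (c : F) : (size c%:P <= 1)%N by apply: size_polyC_leq1.
have sub_le (l : seq F) : (size (\prod_(y <- l) (y%:P + (- 1)%:P * 'X))%R <= (size l).+1)%N.
  by rewrite -[size l]mul1n; apply: size_prod_le => y _; apply: size_affine.
set N := (_ + _).+2; have NE : N = (1 + (size ys + (size ys).+1))%N.
  by rewrite /N addnS.
apply: leq_trans (size_polyD _ _) _; rewrite geq_max; apply/andP; split.
  apply: leq_trans (size_polyD _ _) _; rewrite size_polyN geq_max NE; apply/andP; split.
    apply: size_mul_le; first exact: size_affine.
    by apply: size_mul_le; [exact: sub_le | exact: size_Zpol].
  apply: size_mul_le; first exact: size_affine.
  have -> : (size ys + (size ys).+1 = 2 * size ys + 1)%N by rewrite mul2n -addnn addnS addn1.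
  apply: size_mul_le => //.
  apply: size_prod_le => y _; rewrite -[3%N]/(1 + 2)%N.
  by apply: size_mul_le; apply: size_affine.
rewrite /T3 big_seq.
apply: (big_ind (fun p : {poly F} => size p <= N)%N) => [|p q pN qN|y yys].
- by rewrite size_poly0.
- by apply: leq_trans (size_polyD _ _) _; rewrite geq_max pN qN.
have -> : N = (0 + (1 + (1 + (1 + (size (rem y ys) + (size (rem y ys)).+1)))))%N.
  rewrite NE size_rem //; case: (ys) yys => //= _ l _; rewrite !add1n !add0n.
  by rewrite !(addnS, addSn).
do 4![apply: size_mul_le; first by [exact: size_affine | exact: le1]].
by apply: size_mul_le; [exact: sub_le | exact: size_Zpol].
Qed.

End Interpolation.

(** * Symmetrised sums over permutations *)

Section SumPermutations.
Variables (T : eqType) (A : nmodType).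

Lemma sum_permutations_cons (xs : seq T) (g : seq T -> A) :
  uniq xs -> xs != [::] ->
  \sum_(ys <- permutations xs) g ys
  = \sum_(x <- xs) \sum_(ys <- permutations (rem x xs)) g (x :: ys).
Proof.
move=> uxs xs0; rewrite -big_allpairs_dep; apply: perm_big.
apply: uniq_perm; first exact: permutations_uniq.
  apply: allpairs_uniq_dep => // [x _|]; first exact: permutations_uniq.
  by case=> [x1 l1] [x2 l2] _ _ /= [-> ->].
move=> l; rewrite mem_permutations; apply/idP/allpairsPdep => [pl|[x [ys [xxs]]]].
  case: l => [|x l] in pl *.
    by move: xs0; rewrite -size_eq0 -(perm_size pl).
  have xxs : x \in xs by rewrite -(perm_mem pl) mem_head.
  exists x, l; split=> //; rewrite mem_permutations -(perm_cons x).
  by apply: (perm_trans pl); apply: perm_to_rem.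
rewrite mem_permutations => pys ->.
by apply: (@perm_trans _ (x :: rem x xs)); rewrite ?perm_cons // perm_sym perm_to_rem.
Qed.

Lemma sum_perm_permutations n (x : 'I_n -> T) (g : seq T -> A) : injective x ->
  \sum_(s : 'S_n) g [seq x (s i) | i <- enum 'I_n]
  = \sum_(ys <- permutations [seq x i | i <- enum 'I_n]) g ys.
Proof.
move=> injx.
rewrite -(big_map (fun s : 'S_n => [seq x (s i) | i <- enum 'I_n]) xpredT g) /=.
apply: perm_big; apply: uniq_perm; last 1 first.
- move=> l; rewrite mem_permutations; apply/mapP/idP => [[s _ ->]|].
    rewrite (map_comp x s); apply: perm_map.
    apply: uniq_perm; [by rewrite (map_inj_uniq perm_inj) enum_uniq | exact: enum_uniq |].
    by move=> i; rewrite mem_enum; apply/mapP; exists ((s^-1)%g i); rewrite ?mem_enum ?permKV.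
  move=> pl; have: perm_eq l [tuple x i | i < n].
    by rewrite /= /image_mem /= in pl *; exact: pl.
  case/tuple_permP=> s ->; exists s; first by rewrite mem_index_enum.
  by rewrite /=; apply: eq_map => i; rewrite tnth_mktuple.
- rewrite map_inj_in_uniq ?index_enum_uniq // => s1 s2 _ _ E; apply/permP => i.
  apply: injx; have /eq_in_map/(_ i) := E; apply; exact: mem_enum.
exact: permutations_uniq.
Qed.

End SumPermutations.

Section Pairs.
Variable A : comNzRingType.
Implicit Types (f : A -> A -> A) (xs : seq A).

Fixpoint prod_pairs f xs : A :=
  if xs is x :: xs' then \prod_(y <- xs') f x y * prod_pairs f xs' else 1.

Lemma prod_pairs_rem f x xs : (forall a b, f a b = f b a) -> x \in xs ->
  prod_pairs f xs = \prod_(y <- rem x xs) f x y * prod_pairs f (rem x xs).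
Proof.
move=> fC; elim: xs => //= z xs IH; rewrite inE => /predU1P[->|xxs].
  by rewrite eqxx.
case: eqP => [->|_] //=; rewrite IH // (perm_big _ (perm_to_rem xxs)) /=.
by rewrite !big_cons fC; ring.
Qed.

End Pairs.

(** The sum of the monomials with strictly increasing exponents.  Subtracting
    the first exponent from all of them leaves 0 followed by positive exponents,
    whence the product over [ys']; what is subtracted contributes a geometric
    series in the product of all variables. *)
Fixpoint incr_series (R : comUnitRingType) (ys : seq R) : R :=
  if ys is y :: ys' then
    (\prod_(z <- ys') z) * incr_series ys' / (1 - \prod_(z <- ys) z)
  else 1.

Section Symmetrisation.
Variables (F : fieldType) (s : F).
Implicit Types (x y z : F) (xs ys : seq F).
Local Notation w := (s ^+ 2 - 2%:R).

Definition littlewood_den xs : F :=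
  \prod_(x <- xs) (1 - x) * prod_pairs (fun x y => 1 - x * y) xs.

(** Both sides satisfy the same recursion on the number of variables: on the
    left one splits by the variable in the first place, on the right one uses
    [Zpol_recursion]. *)
Lemma littlewood_sum xs : generic xs ->
  (forall ys, ys != [::] -> {subset ys <= xs} -> \prod_(y <- ys) y != 1) ->
  \sum_(ys <- permutations xs)
     prod_pairs (fun y z => (1 + w * y + y * z) / (z - y)) ys * incr_series ys
  = Zpol s xs / littlewood_den xs.
Proof.
have [n] := ubnP (size xs); elim: n xs => // n IH xs ltn g nz1.
have [->|xs0] := eqVneq xs [::].
  by rewrite big_seq1 /littlewood_den /= !big_nil !mulr1 Zpol_nil divr1.
have uxs : uniq xs by case: g.
have P1 : 1 - \prod_(x <- xs) x != 0 by rewrite subr_eq0 eq_sym nz1.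
apply: (mulfI P1); rewrite mulrA (Zpol_recursion s g) mulr_sumr mulr_suml.
rewrite sum_permutations_cons //; apply: eq_big_seq => x xxs.
have E ys : ys \in permutations (rem x xs) ->
  (1 - \prod_(x <- xs) x) * (prod_pairs (fun y z => (1 + w * y + y * z) / (z - y)) (x :: ys)
     * incr_series (x :: ys)) = 
  \prod_(z <- rem x xs) (z * ((1 + w * x + x * z) / (z - x))) *
   (prod_pairs (fun y z => (1 + w * y + y * z) / (z - y)) ys * incr_series ys).
  rewrite mem_permutations => pys /=.
  rewrite (perm_big _ (perm_to_rem xxs)) /= !big_cons !(perm_big _ pys) /= !big_split /=.
  by field; move: P1; rewrite (perm_big _ (perm_to_rem xxs)) /= big_cons.
rewrite (eq_big_seq _ E) -mulr_sumr IH; first last.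
- by move=> ys ys0 sub; apply: nz1 => // y /sub; apply: mem_rem.
- exact: generic_rem.
- by rewrite size_rem //; case: (xs) xs0 ltn.
have x1 : 1 - x != 0.
  by rewrite subr_eq0 eq_sym; case: g => _ _ n1 _; apply: contraNneq n1 => <-.
have D0 : \prod_(y <- rem x xs) (1 - x * y) != 0.
  rewrite prodf_seq_neq0; apply/allP => y yxs /=; rewrite subr_eq0 eq_sym.
  by case: g => _ _ _ n2; rewrite n2 // (mem_rem yxs).
have -> : littlewood_den xs
    = (1 - x) * \prod_(y <- rem x xs) (1 - x * y) * littlewood_den (rem x xs).
  rewrite /littlewood_den (perm_big _ (perm_to_rem xxs)) /= big_cons.
  by rewrite (prod_pairs_rem _ xxs) => [|a b]; [ring | rewrite mulrC].
have -> : \prod_(y <- rem x xs) rec_coef s x y = \prod_(y <- rem x xs) (1 - x * y) *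
    \prod_(z <- rem x xs) (z * ((1 + w * x + x * z) / (z - x))).
  by rewrite -big_split; apply: eq_bigr => y _; rewrite /rec_coef /=; ring.
move: (littlewood_den (rem x xs)) => d; rewrite !invfM; move: d^-1 => dV.
by field; rewrite D0 x1.
Qed.

End Symmetrisation.

(** * Power series: leading monomials and vanishing order *)

Section MinimalMonomial.
Variables (n : nat) (K : idomainType).
Implicit Types (f g : mfps n K) (m : 'X_{1..n}).

Definition min_monomial f m := f m != 0 /\ forall m', (m' < m)%O -> f m' = 0.

Lemma min_monomialP f m : f m != 0 -> exists2 m0, (m0 <= m)%O & min_monomial f m0.
Proof.
elim/(well_founded_induction (@ltom_wf n)): m => m IH fm.
have [[m' [lt fm']]|no] := pselect (exists m', (m' < m)%O /\ f m' != 0).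
  by have [m0 le min] := IH m' lt fm'; exists m0; rewrite ?(le_trans le (ltW lt)).
exists m => //; split=> // m' lt; apply/eqP/negPn/negP => fm'.
by apply: no; exists m'.
Qed.

(** The monomial order is compatible with addition, so no other pair of
    monomials of [f] and [g] contributes to this coefficient. *)
Lemma mfpsM_min f g m1 m2 : min_monomial f m1 -> min_monomial g m2 ->
  (f * g) (m1 + m2)%MM = f m1 * g m2.
Proof.
move=> [_ f0] [_ g0]; rewrite mfpsM.
have lt1 : (mdeg m1 < (mdeg (m1 + m2)%MM).+1)%N by rewrite mdegD ltnS leq_addr.
have lt2 : (mdeg m2 < (mdeg (m1 + m2)%MM).+1)%N by rewrite mdegD ltnS leq_addl.
rewrite (bigD1 (BMultinom lt1, BMultinom lt2)) //= big1 ?addr0 //.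
move=> [k1 k2] /= /andP[/eqP e ne].
have [lt|gt|eq1] := ltgtP (bmnm k1) m1; first by rewrite f0 ?mul0r.
  have [lt2'|ge] := ltP (bmnm k2) m2; first by rewrite g0 ?mulr0.
  by have := ltmc_le_add gt ge; rewrite -e ltxx.
case/eqP: ne; congr (_, _); apply: val_inj => //=.
by move/eqP: e; rewrite eq1 eqm_add2l => /eqP.
Qed.

Fact mfps_integral : GRing.integral_domain_axiom (mfps n K).
Proof.
move=> f g fg0; apply/orP.
have [//|nf] := pselect (f == 0 \/ g == 0).
have nz h : h != 0 -> exists m, min_monomial h m.
  move=> h0; have [[m hm]|no] := pselect (exists m, h m != 0).
    by have [m0 _ ?] := min_monomialP hm; exists m0.
  case/eqP: h0; apply: mfpsP => m; apply/eqP/negPn/negP => hm.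
  by apply: no; exists m.
have [m1 f1] : exists m, min_monomial f m.
  by apply: nz; apply/negP => ?; apply: nf; left.
have [m2 g1] : exists m, min_monomial g m.
  by apply: nz; apply/negP => ?; apply: nf; right.
have := mfpsM_min f1 g1; rewrite fg0 => /esym/eqP.
by rewrite mulf_eq0 (negbTE f1.1) (negbTE g1.1).
Qed.

HB.instance Definition _ :=
  GRing.ComUnitRing_isIntegral.Build (mfps n K) mfps_integral.

(** Membership in the [B]-th power of the ideal of series without constant
    term. *)
Definition vanish (B : nat) f := forall m, (mdeg m < B)%N -> f m = 0.

(** A multiplier with a nonzero coefficient in degree d raises the order of
    vanishing by at most d.  This is how an approximate identity survives the
    division by the Vandermonde product. *)
Lemma vanish_cancel a f g m : g m != 0 -> vanish (a + mdeg m) (f * g) -> vanish a f.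
Proof.
move=> gm van m' lt; apply/eqP/negPn/negP => fm'.
have [m1 le1 f1] := min_monomialP fm'; have [m2 le2 g2] := min_monomialP gm.
have := mfpsM_min f1 g2; rewrite van => [/esym/eqP|].
  by rewrite mulf_eq0 (negbTE f1.1) (negbTE g2.1).
rewrite mdegD -addSn leq_add ?(lemc_mdeg le2) //.
exact: leq_ltn_trans (lemc_mdeg le1) lt.
Qed.

Lemma vanishD B f g : vanish B f -> vanish B g -> vanish B (f + g).
Proof. by move=> vf vg m lt; rewrite mfpsD vf ?vg ?addr0. Qed.

Lemma vanish_sum (I : eqType) (r : seq I) (F : I -> mfps n K) B :
  {in r, forall i, vanish B (F i)} -> vanish B (\sum_(i <- r) F i).
Proof. by move=> vF m lt; rewrite mfps_sum big1_seq // => i /= ir; apply: vF. Qed.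

Lemma vanishM a b f g : vanish a f -> vanish b g -> vanish (a + b) (f * g).
Proof.
move=> vf vg m lt; rewrite mfpsM big1 // => -[k1 k2] /= /eqP e.
have [lt1|le1] := ltnP (mdeg k1) a; first by rewrite vf ?mul0r.
rewrite vg ?mulr0 // -(ltn_add2l (mdeg k1)).
rewrite -mdegD -e; apply: leq_trans lt _; by rewrite leq_add2r.
Qed.

Lemma vanishMl B f g : vanish B g -> vanish B (f * g).
Proof. by move=> vg; rewrite -[B]add0n; apply: vanishM. Qed.

Lemma vanish_leq a b f : (a <= b)%N -> vanish b f -> vanish a f.
Proof. by move=> le vf m lt; apply: vf; apply: leq_trans lt le. Qed.

End MinimalMonomial.

(** * Sums over strictly increasing exponents *)

Section StrictlyIncreasing.

(** The strictly increasing sequences of length [n] with entries below [B], built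
    along the same recursion as [incr_series]: the first entry is 0 or all
    entries can be lowered. *)
Fixpoint incr_seqs (B n : nat) : seq (seq nat) :=
  match B, n with
  | _, 0 => [:: [::]]
  | 0, _.+1 => [::]
  | B'.+1, n'.+1 => [seq 0%N :: map succn ks | ks <- incr_seqs B' n']
                    ++ [seq map succn ks | ks <- incr_seqs B' n]
  end.

Lemma sorted_succ ks : sorted ltn (map succn ks) = sorted ltn ks.
Proof. by rewrite sorted_map; apply: eq_sorted. Qed.

Lemma mem_map_succ ks (L : seq (seq nat)) :
  (ks \in map (map succn) L) = all (ltn 0) ks && (map predn ks \in L).
Proof.
apply/mapP/andP => [[l lL ->]|[pos kL]].
  by rewrite all_map -map_comp map_id; split=> //; apply/allP.
exists (map predn ks) => //; rewrite -map_comp map_id_in // => k kks /=.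
by rewrite prednK //; exact: (allP pos).
Qed.

Lemma sorted_pred ks : all (ltn 0) ks -> sorted ltn (map predn ks) = sorted ltn ks.
Proof.
move=> pos; rewrite -[in RHS](@map_id_in _ (succn \o predn) ks); last first.
  by move=> k kks /=; rewrite prednK //; exact: (allP pos).
by rewrite map_comp sorted_succ.
Qed.

Lemma all_ltn_pred B ks : all (ltn 0) ks ->
  all (ltn^~ B) (map predn ks) = all (ltn^~ B.+1) ks.
Proof.
move=> pos; rewrite all_map; apply: eq_in_all => k kks /=.
by rewrite -[in RHS](@prednK k) ?ltnS //; exact: (allP pos).
Qed.

Lemma mem_incr_seqs B n ks :
  (ks \in incr_seqs B n) = [&& size ks == n, sorted ltn ks & all (ltn^~ B) ks].
Proof.
elim: B n ks => [|B IH] [|n] ks /=; try by rewrite inE -size_eq0; case: ks.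
  by case: ks => [|k ks] //=; rewrite !andbF.
rewrite mem_cat (map_comp (cons 0%N) (map succn)) mem_map_succ IH.
have [pos|npos] /= := boolP (all (ltn 0) ks).
  rewrite size_map sorted_pred // all_ltn_pred // (_ : (ks \in _) = false) //.
  by apply/mapP => -[l _ E]; rewrite E in pos.
case: ks npos => [|[|k] ks] //= npos.
  have inj0 : injective (cons 0%N) by move=> a b [].
  rewrite orbF (mem_map inj0) mem_map_succ IH eqSS.
  have [pos|npos'] /= := boolP (all (ltn 0) ks).
    rewrite size_map sorted_pred // all_ltn_pred //.
    by rewrite (path_sortedE ltn_trans) pos.
  by rewrite (path_sortedE ltn_trans) (negbTE npos') andbF.
rewrite orbF; apply/esym; rewrite (path_sortedE ltn_trans).
rewrite (_ : (_ \in _) = false); last by apply/mapP => -[].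
apply/negP => /and3P[_ /andP[gt _] _]; case/negP: npos.
by apply: sub_all gt => a; apply: leq_trans.
Qed.

Lemma incr_seqs_uniq B n : uniq (incr_seqs B n).
Proof.
have succ_inj : injective (map succn) by apply: inj_map => i j [].
elim: B n => [|B IH] [|n] //=; rewrite cat_uniq !map_inj_uniq ?IH //.
  rewrite andbT; apply/hasPn => _ /mapP[ks _ ->]; apply/mapP => -[ks' _].
  by case: ks.
by move=> ks ks' [] /succ_inj.
Qed.

End StrictlyIncreasing.

Fixpoint powers (R : comNzRingType) (ys : seq R) (ks : seq nat) : R :=
  match ys, ks with
  | y :: ys', k :: ks' => y ^+ k * powers ys' ks'
  | _, _ => 1
  end.

Lemma powers_succ (R : comNzRingType) (ys : seq R) ks : size ks = size ys ->
  powers ys (map succn ks) = \prod_(y <- ys) y * powers ys ks.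
Proof.
elim: ys ks => [|y ys IH] [|k ks] //=; rewrite ?big_nil ?mulr1 // => -[sz].
by rewrite IH // big_cons exprS; ring.
Qed.

Lemma powers_tuple (R : comNzRingType) n (y : 'I_n -> R) (k : n.-tuple nat) :
  powers [seq y i | i <- enum 'I_n] k = \prod_(i < n) y i ^+ tnth k i.
Proof.
elim: n y k => [|n IH] y k; first by rewrite big_ord0 enum_ord0.
case/tupleP: k => k0 k; rewrite enum_ordSl /= big_ord_recl tnth0; congr (_ * _).
rewrite -map_comp IH; apply: eq_bigr => i _; by rewrite tnthS.
Qed.

Lemma prod_pairs_enum (R : comNzRingType) n (y : 'I_n -> R) f :
  prod_pairs f [seq y i | i <- enum 'I_n]
  = \prod_(i < n) \prod_(j < n | (i < j)%N) f (y i) (y j).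
Proof.
elim: n y => [|n IH] y; first by rewrite big_ord0 enum_ord0.
rewrite enum_ordSl /= big_ord_recl; congr (_ * _).
  rewrite big_map big_map big_enum [RHS]big_mkcond [RHS]big_ord_recl /= mul1r.
  by apply: eq_bigr => i _.
rewrite -map_comp IH; apply: eq_bigr => i _.
rewrite [RHS]big_mkcond big_ord_recl /= mul1r [LHS]big_mkcond.
by apply: eq_bigr => j _.
Qed.

Section Series.
Variables (n : nat) (K : fieldType).
Implicit Types (y : mfps n K) (ys : seq (mfps n K)).

Lemma incr_series_step y ys : 1 - \prod_(z <- y :: ys) z \is a GRing.unit ->
  incr_series (y :: ys) = \prod_(z <- ys) z * incr_series ys
                          + \prod_(z <- y :: ys) z * incr_series (y :: ys).
Proof.
move=> u; apply/eqP; rewrite -subr_eq -{1}[incr_series _]mul1r -mulrBl.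
by rewrite [incr_series (y :: ys)]/= mulrC divrK.
Qed.

Lemma vanish_unit f : vanish 1 f -> 1 - f \is a @GRing.unit (mfps n K).
Proof.
move=> f0; rewrite -[_ \is a _]/(mfps_unit _) /mfps_unit unitfE mfpsD mfpsN.
by rewrite f0 ?mdeg0 //= mcoeff1 eqxx subr0 oner_eq0.
Qed.

Lemma vanish_prod y ys : {in y :: ys, forall z, vanish 1 z} ->
  vanish 1 (\prod_(z <- y :: ys) z).
Proof.
move=> v; rewrite big_cons mulrC; apply: vanishMl; apply: v; exact: mem_head.
Qed.

(** The sum and its rational value obey the same recursion in [B], in which every
    step multiplies the error by a product of variables. *)
Lemma sum_powers_incr_series B ys : {in ys, forall y, vanish 1 y} ->
  vanish B (\sum_(ks <- incr_seqs B (size ys)) powers ys ks - incr_series ys).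
Proof.
elim: B ys => [|B IH] ys v //; case: ys v => [|y ys] v.
  by rewrite big_seq1 subrr.
have vys : {in ys, forall z, vanish 1 z}.
  by move=> z zys; apply: v; rewrite inE zys orbT.
rewrite incr_series_step; last by apply: vanish_unit; apply: vanish_prod.
rewrite [size _]/= big_cat !big_map /=.
have E1 : \sum_(ks <- incr_seqs B (size ys)) y ^+ 0 * powers ys (map succn ks)
   = \prod_(z <- ys) z * \sum_(ks <- incr_seqs B (size ys)) powers ys ks.
  rewrite mulr_sumr; apply: eq_big_seq => ks; rewrite mem_incr_seqs => /andP[/eqP sz _].
  by rewrite powers_succ // mul1r.
have E2 : \sum_(ks <- incr_seqs B (size ys).+1) powers (y :: ys) (map succn ks)
   = \prod_(z <- y :: ys) z * \sum_(ks <- incr_seqs B (size ys).+1) powers (y :: ys) ks.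
  rewrite mulr_sumr; apply: eq_big_seq => ks; rewrite mem_incr_seqs => /andP[/eqP sz _].
  by rewrite powers_succ.
rewrite E1 E2 opprD addrACA -!mulrBr; apply: vanishD.
  case: ys v vys IH {E1 E2} => [|z ys] v vys IH.
    have -> : incr_seqs B (size (Nil (mfps n K))) = [:: [::]] by case: (B).
    by rewrite big_seq1 subrr mulr0.
  by rewrite -add1n; apply: vanishM; [apply: vanish_prod | apply: IH].
by rewrite -add1n; apply: vanishM; [apply: vanish_prod | apply: (IH (y :: ys))].
Qed.

End Series.

(** * The identity for the antisymmetriser in the power series ring *)

Notation "x %:F" := (@FracField.tofrac _ x).

(** The product is a Vandermonde determinant with permuted columns. *)
Lemma prod_sub_perm (R : comNzRingType) n (x : 'I_n -> R) (p : 'S_n) :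
  \prod_(i < n) \prod_(j < n | (i < j)%N) (x (p j) - x (p i))
  = (-1) ^+ p * \prod_(i < n) \prod_(j < n | (i < j)%N) (x j - x i).
Proof.
have V y : \prod_(i < n) \prod_(j < n | (i < j)%N) (y j - y i)
    = \det (Vandermonde n (\row_i y i)) :> R.
  rewrite det_Vandermonde; apply: eq_bigr => i _; apply: eq_bigr => j _.
  by rewrite !mxE.
rewrite (V (fun i => x (p i))) V mulrC.
have -> : Vandermonde n (\row_i x (p i)) = col_perm p (Vandermonde n (\row_i x i)).
  by apply/matrixP => i j; rewrite !mxE.
by rewrite col_permE det_mulmx det_perm odd_permV.
Qed.

Lemma rmorph_prod_pairs (A B : comNzRingType) (g : {rmorphism A -> B}) f f' xs :
  (forall a b, g (f a b) = f' (g a) (g b)) -> g (prod_pairs f xs) = prod_pairs f' (map g xs).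
Proof.
move=> gf; elim: xs => [|x xs IH] /=; first exact: rmorph1.
rewrite rmorphM IH rmorph_prod big_map; congr (_ * _).
by apply: eq_bigr => y _; exact: gf.
Qed.

Section Kernel.
Variables (n : nat) (K : fieldType) (w : K).
Local Notation X i := (mfpsX K i).
Local Notation Xs p := [seq X (fun_of_perm p i) | i <- enum 'I_n].

Definition robbins_factor (y z : mfps n K) := 1 + mfpsC n w * y + y * z.

Lemma asym_kernel (k : n.-tuple nat) :
  mfps_of_mpoly (asym (robbins_kernel k 1 1 w))
  = \sum_(p : 'S_n) (-1) ^+ p * (prod_pairs robbins_factor (Xs p) * powers (Xs p) k).
Proof.
rewrite /asym rmorph_sum; apply: eq_bigr => p _.
rewrite rmorphM rmorph_sign; congr (_ * _).
have mX i : mfps_of_mpoly (msym p 'X_i) = X (p i) by rewrite /msym mmapX mmap1U.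
rewrite /robbins_kernel !rmorphM; congr (_ * _).
  rewrite prod_pairs_enum !rmorph_prod; apply: eq_bigr => i _.
  rewrite !rmorph_prod; apply: eq_bigr => j _ /=.
  rewrite !(rmorphD, rmorphM) /= !mX.
  have mC c : msym p c%:MP = c%:MP :> {mpoly K[n]} by rewrite /msym mmapC.
  by rewrite !mC /robbins_factor /mfpsC !rmorph1; ring.
rewrite powers_tuple !rmorph_prod; apply: eq_bigr => i _.
by rewrite !rmorphXn; congr (_ ^+ _); exact: mX.
Qed.

Lemma vandermondeE :
  mfps_of_mpoly (vandermonde n K) = \prod_(i < n) \prod_(j < n | (i < j)%N) (X j - X i).
Proof.
rewrite rmorph_prod; apply: eq_bigr => i _; rewrite rmorph_prod.
by apply: eq_bigr => j _; rewrite rmorphB.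
Qed.

Lemma vanish_X (i : 'I_n) : vanish 1 (X i).
Proof.
move=> m; rewrite ltnS leqn0 mdeg_eq0 => /eqP ->.
by rewrite /mfpsX /= mcoeffX mnm1_eq0.
Qed.

Lemma mfpsX_inj : injective (@mfpsX n K).
Proof.
move=> i j /(congr1 (fun f : mfps n K => f U_(j)%MM)) /=.
rewrite !mcoeffXU eqxx; case: eqP => // _ /eqP.
by rewrite eq_sym oner_eq0.
Qed.

End Kernel.

Section Littlewood.
Variables (n : nat) (K : fieldType) (s : K).
Local Notation w := (s ^+ 2 - 2%:R).
Local Notation X i := (mfpsX K i).
Local Notation Xs p := [seq X (fun_of_perm p i) | i <- enum 'I_n].
Local Notation phi := (@FracField.tofrac (mfps n K)).

Lemma rmorph_incr_series (ys : seq (mfps n K)) : {in ys, forall y, vanish 1 y} ->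
  phi (incr_series ys) = incr_series (map phi ys).
Proof.
elim: ys => [|y ys IH] v; first exact: rmorph1.
have vys : {in ys, forall z, vanish 1 z}.
  by move=> z zys; apply: v; rewrite inE zys orbT.
rewrite /= !tofracM IH // rmorphV; last exact: vanish_unit (vanish_prod v).
by rewrite /= tofracB tofrac1 !rmorph_prod /= !big_cons !big_map.
Qed.

Lemma generic_X : generic [seq phi (X i) | i <- enum 'I_n].
Proof.
have nz1 (f : mfps n K) : vanish 1 f -> f != 1.
  move=> v; apply/eqP => /(congr1 (fun f : mfps n K => f 0%MM)).
  by rewrite v ?mdeg0 //= mcoeff1 eqxx => /esym/eqP; rewrite oner_eq0.
split.
- by rewrite map_inj_uniq ?enum_uniq // => i j /eqP; rewrite tofrac_eq => /eqP/mfpsX_inj.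
- apply/mapP => -[i _ /eqP]; rewrite eq_sym tofrac_eq0 => /eqP.
  move=> /(congr1 (fun f : mfps n K => f U_(i)%MM)) /= /eqP.
  by rewrite mcoeffXU eqxx oner_eq0.
- apply/mapP => -[i _ /eqP]; rewrite -tofrac1 tofrac_eq eq_sym; apply/negP/nz1.
  exact: vanish_X.
move=> _ _ /mapP[i _ ->] /mapP[j _ ->]; rewrite -tofracM -tofrac1 tofrac_eq.
by apply: nz1; apply: vanishMl; exact: vanish_X.
Qed.

(** [littlewood_sum] holds in the fraction field of the power series ring, into
    which the series embed.  All denominators other than the Vandermonde
    product are invertible series, and that one is, up to the sign of the
    permutation, common to all summands. *)
Lemma littlewood_mfps :
  \sum_(p : 'S_n) (-1) ^+ p * (prod_pairs (robbins_factor w) (Xs p) * incr_series (Xs p))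
  = mfps_of_mpoly (vandermonde n K) *
    ((\prod_(i < n) (1 - X i)^-1) *
     (\prod_(i < n) \prod_(j < n | (i < j)%N) (1 - X i * X j)^-1) *
     Zpol (mfpsC n s) [seq X i | i <- enum 'I_n]).
Proof.
apply/eqP; rewrite -tofrac_eq; apply/eqP.
have mC : mfpsC n w = mfpsC n s ^+ 2 - 2%:R.
  by rewrite /mfpsC !rmorphB !rmorphXn /= !rmorph_nat.
rewrite rmorph_sum.
transitivity (\sum_(p : 'S_n) phi (mfps_of_mpoly (vandermonde n K)) *
   (prod_pairs (fun y z => (1 + ((mfpsC n s)%:F ^+ 2 - 2%:R) * y + y * z) / (z - y))
      [seq phi (X (p i)) | i <- enum 'I_n]
    * incr_series [seq phi (X (p i)) | i <- enum 'I_n])).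
  apply: eq_bigr => p _; rewrite /= !tofracM [((-1) ^+ p)%:F]rmorph_sign.
  rewrite rmorph_incr_series; last first.
    by move=> _ /mapP[i _ ->]; apply: vanish_X.
  have XE : map phi (Xs p) = [seq phi (X (p i)) | i <- enum 'I_n].
    exact: esym (map_comp _ _ _).
  rewrite !mulrA XE; congr (_ * _).
  rewrite (@rmorph_prod_pairs _ _ _ _ (fun y z => 1 + ((mfpsC n s)%:F ^+ 2 - 2%:R) * y + y * z));
    last first.
    move=> a b; rewrite /= /robbins_factor mC !(tofracD, tofracB, tofracM, tofracXn, tofrac1).
    by rewrite rmorphN rmorph_nat.
  rewrite XE !prod_pairs_enum /=.
  under [in RHS]eq_bigr => i _ do rewrite big_split /= prodfV.
  rewrite big_split /= prodfV (prod_sub_perm (fun i => phi (X i))) vandermondeE.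
  have -> : (\prod_(i < n) \prod_(j < n | (i < j)%N) (X j - X i))%:F
      = \prod_(i < n) \prod_(j < n | (i < j)%N) (phi (X j) - phi (X i)).
    rewrite rmorph_prod; apply: eq_bigr => i _; rewrite rmorph_prod.
    by apply: eq_bigr => j _; rewrite /= tofracB.
  set V := \prod_(i < n) _; set N := \prod_(i < n) _.
  have V0 : V != 0.
    apply/prodf_neq0 => i _; apply/prodf_neq0 => j ij.
    rewrite subr_eq0 tofrac_eq; apply/eqP => /mfpsX_inj ji.
    by rewrite ji ltnn in ij.
  clearbody V N; rewrite invfM -exprVn invrN1; move: ((-1) ^+ p) => e.
  by rewrite mulrCA [V * _]mulrC divfK // mulrC.
rewrite -mulr_sumr [in RHS]tofracM; congr (_ * _).
rewrite (sum_perm_permutations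
  (fun ys => prod_pairs (fun y z =>
     (1 + ((mfpsC n s)%:F ^+ 2 - 2%:R) * y + y * z) / (z - y)) ys * incr_series ys)
  (x := fun i => phi (X i))); last first.
  by move=> i j /eqP; rewrite tofrac_eq => /eqP/mfpsX_inj.
rewrite littlewood_sum; first last.
- move=> ys ys0 sub.
  suff [f [-> v]] : exists f, \prod_(y <- ys) y = phi f /\ vanish 1 f.
    rewrite -tofrac1 tofrac_eq; apply/eqP => /(congr1 (fun f : mfps n K => f 0%MM)).
    by rewrite v ?mdeg0 //= mcoeff1 eqxx => /esym/eqP; rewrite oner_eq0.
  elim: ys ys0 sub => // y ys IH _ sub.
  have /mapP[i _ ->] : y \in [seq phi (X i) | i <- enum 'I_n] by apply: sub; apply: mem_head.
  case: ys IH sub => [|z ys] IH sub.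
    by exists (X i); rewrite big_seq1; split=> //; apply: vanish_X.
  have [//|t ht|f [E v]] := IH; first by apply: sub; rewrite inE ht orbT.
  exists (X i * f); rewrite big_cons E tofracM; split=> //.
  by apply: vanishMl.
- exact: generic_X.
rewrite tofracM rmorph_Zpol -(map_comp phi) mulrC; congr (_ * _).
rewrite /littlewood_den prod_pairs_enum invfM big_map big_enum /= tofracM; congr (_ * _).
  rewrite -prodfV rmorph_prod; apply: eq_bigr => i _ /=.
  rewrite rmorphV; last by apply: vanish_unit; exact: vanish_X.
  by rewrite /= tofracB tofrac1.
rewrite -prodfV rmorph_prod; apply: eq_bigr => i _ /=.
rewrite -prodfV rmorph_prod; apply: eq_bigr => j _ /=.
rewrite rmorphV; last by apply: vanish_unit; apply: vanishMl; exact: vanish_X.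
by rewrite /= tofracB tofracM tofrac1.
Qed.

End Littlewood.

(** * Orientations of the triangular graph in coordinates *)

Section Coordinates.
Variable n : nat.
Implicit Types (o : orientation n) (p q : grid_index n) (i j : nat).

Lemma grid_index_eq p q :
  (val p).1 = (val q).1 :> nat -> (val p).2 = (val q).2 :> nat -> p = q.
Proof.
move=> e1 e2; apply: val_inj; case: (val p) (val q) e1 e2 => [a b] [c d] /= e1 e2.
by congr (_, _); apply: val_inj.
Qed.

Definition index_at i j : option (grid_index n) :=
  [pick p : grid_index n | ((val p).1 == i :> nat) && ((val p).2 == j :> nat)].

Lemma index_atK p : index_at (val p).1 (val p).2 = Some p.
Proof.
rewrite /index_at; case: pickP => [q /andP[/eqP e1 /eqP e2]|/(_ p)]; last by rewrite !eqxx.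
by congr Some; apply: grid_index_eq.
Qed.

Lemma index_at_ex i j : (i <= j < n)%N ->
  exists p, [/\ index_at i j = Some p, (val p).1 = i :> nat & (val p).2 = j :> nat].
Proof.
move=> /andP[ij jn].
have le : (Ordinal (leq_ltn_trans ij jn) <= Ordinal jn)%N by [].
exists (exist _ (Ordinal (leq_ltn_trans ij jn), Ordinal jn) le); split=> //.
exact: (index_atK (exist _ (Ordinal (leq_ltn_trans ij jn), Ordinal jn) le)).
Qed.

(** Bits of the edges with natural-number coordinates; outside of the grid the
    value is [false]. *)
Definition vert o i j := if index_at i j is Some p then o (inl p) else false.
Definition horiz o i j := if index_at i j is Some p then o (inr p) else false.

Definition of_coords (fv fh : nat -> nat -> bool) : orientation n :=
  [ffun e : edge n => match e with
             | inl p => fv (val p).1 (val p).2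
             | inr p => fh (val p).1 (val p).2
             end].

Lemma vert_of_coords fv fh i j : (i <= j < n)%N -> vert (of_coords fv fh) i j = fv i j.
Proof. by rewrite /vert => /index_at_ex[p [-> <- <-]]; rewrite ffunE. Qed.

Lemma horiz_of_coords fv fh i j : (i <= j < n)%N -> horiz (of_coords fv fh) i j = fh i j.
Proof. by rewrite /horiz => /index_at_ex[p [-> <- <-]]; rewrite ffunE. Qed.

Lemma of_coords_eq o fv fh : (forall i j, (i <= j < n)%N -> fv i j = vert o i j) ->
  (forall i j, (i <= j < n)%N -> fh i j = horiz o i j) -> of_coords fv fh = o.
Proof.
move=> ev eh; apply/ffunP => -[p|p]; rewrite ffunE.
  by rewrite ev ?(valP p) /= ?ltn_ord // /vert index_atK.
by rewrite eh ?(valP p) /= ?ltn_ord // /horiz index_atK.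
Qed.

(** Along an edge the sum of the coordinates increases, so no edge is the
    reversal of another one. *)
Lemma endpoints_ltn (e : edge n) : ((endpoints e).1.1 + (endpoints e).1.2
  < (endpoints e).2.1 + (endpoints e).2.2)%N :> bool.
Proof. by case: e => [] [[i j] ?] /=; rewrite ?addSn ?addnS. Qed.

Lemma endpoints_inj : injective (@endpoints n).
Proof.
have vE p : endpoints (inl p) = (((val p).1 : nat, (val p).2.+1), ((val p).1.+1, (val p).2.+1)).
  by case: p => [[i j] ?].
have hE p : endpoints (inr p) = (((val p).1.+1, (val p).2.+1), ((val p).1.+1, (val p).2.+2)).
  by case: p => [[i j] ?].
move=> [p|p] [q|q]; rewrite ?vE ?hE => -[].
- by move=> e1 e2; rewrite (grid_index_eq e1 e2).
- by move=> -> _ /eqP; rewrite gtn_eqF.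
- by move=> <- _ /eqP; rewrite ltn_eqF.
by move=> e1 e2; rewrite (grid_index_eq e1 e2).
Qed.

Lemma arrow_forward o e : arrow o (endpoints e).1 (endpoints e).2 = o e.
Proof.
apply/existsP/idP => [[e' /andP[]]|oe]; last by exists e; rewrite /tail /Defs.head oe /= !eqxx.
rewrite /tail /Defs.head; case: ifP => oe' /eqP e1 /eqP e2.
  have -> // : e = e'.
  by apply: endpoints_inj; rewrite (surjective_pairing (endpoints e)) -e1 -e2 -surjective_pairing.
have := endpoints_ltn e; rewrite -e1 -e2.
by have := endpoints_ltn e'; move=> l1 l2; have := ltn_trans l1 l2; rewrite ltnn.
Qed.

Lemma arrow_backward o e : arrow o (endpoints e).2 (endpoints e).1 = ~~ o e.
Proof.
apply/existsP/idP => [[e' /andP[]]|oe]; last first.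
  by exists e; rewrite /tail /Defs.head (negbTE oe) /= !eqxx.
rewrite /tail /Defs.head; case: ifP => oe' /eqP e1 /eqP e2.
  have := endpoints_ltn e; rewrite -e1 -e2.
  by have := endpoints_ltn e'; move=> l1 l2; have := ltn_trans l1 l2; rewrite ltnn.
have -> : e = e'; last by rewrite oe'.
by apply: endpoints_inj; rewrite (surjective_pairing (endpoints e)) -e1 -e2 -surjective_pairing.
Qed.

Lemma arrow_up o i j : (i <= j < n)%N -> arrow o (i.+1, j.+1) (i, j.+1) = ~~ vert o i j.
Proof.
rewrite /vert => /index_at_ex[[[a b] ab] /= [-> <- <-]].
by rewrite -(arrow_backward o (inl (exist _ (a, b) ab))).
Qed.

Lemma arrow_right o i j : (i <= j < n)%N -> arrow o (i.+1, j.+1) (i.+1, j.+2) = horiz o i j.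
Proof.
rewrite /horiz => /index_at_ex[[[a b] ab] /= [-> <- <-]].
by rewrite -(arrow_forward o (inr (exist _ (a, b) ab))).
Qed.

End Coordinates.
Arguments of_coords {n} fv fh.

Section Degrees.
Variable n : nat.
Implicit Types (o : orientation n) (p q : grid_index n) (i j : nat).

Lemma sum_index_at (f : grid_index n -> bool) i j :
  (\sum_(p : grid_index n) (((val p).1 == i :> nat) && ((val p).2 == j :> nat) && f p)
   = if index_at n i j is Some p then f p : nat else 0)%N.
Proof.
rewrite /index_at; case: pickP => [p /andP[/eqP e1 /eqP e2]|no].
  rewrite (bigD1 p) //= e1 e2 !eqxx big1 ?addn0 // => q qp.
  case: andP => // -[/andP[/eqP f1 /eqP f2] _]; case/eqP: qp.
  by apply: grid_index_eq; rewrite ?f1 ?f2.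
by rewrite big1 // => p _; rewrite no.
Qed.

Lemma indegreeE o (a : vertex) : indegree o a =
  (\sum_(p : grid_index n) (((endpoints (inl p)).2 == a) && o (inl p))
 + \sum_(p : grid_index n) (((endpoints (inr p)).2 == a) && o (inr p))
 + (\sum_(p : grid_index n) (((endpoints (inl p)).1 == a) && ~~ o (inl p))
 + \sum_(p : grid_index n) (((endpoints (inr p)).1 == a) && ~~ o (inr p))))%N.
Proof.
rewrite /indegree -sum1dep_card big_mkcond /= big_sumType /= addnACA.
by congr (_ + _)%N; rewrite -big_split; apply: eq_bigr => p _; rewrite /Defs.head /=;
  case: (o _); rewrite /= ?andbT ?andbF ?addn0 ?add0n; case: (_ == a).
Qed.

Lemma outdegreeE o (a : vertex) : outdegree o a =
  (\sum_(p : grid_index n) (((endpoints (inl p)).2 == a) && ~~ o (inl p))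
 + \sum_(p : grid_index n) (((endpoints (inr p)).2 == a) && ~~ o (inr p))
 + (\sum_(p : grid_index n) (((endpoints (inl p)).1 == a) && o (inl p))
 + \sum_(p : grid_index n) (((endpoints (inr p)).1 == a) && o (inr p))))%N.
Proof.
rewrite /outdegree -sum1dep_card big_mkcond /= big_sumType /= addnACA.
by congr (_ + _)%N; rewrite -big_split; apply: eq_bigr => p _; rewrite /tail /=;
  case: (o _); rewrite /= ?andbT ?andbF ?addn0 ?add0n; case: (_ == a).
Qed.

Lemma endpoints_inl p : endpoints (inl p)
  = (((val p).1 : nat, (val p).2.+1), ((val p).1.+1, (val p).2.+1)).
Proof. by case: p => [[i j] ?]. Qed.

Lemma endpoints_inr p : endpoints (inr p)
  = (((val p).1.+1, (val p).2.+1), ((val p).1.+1, (val p).2.+2)).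
Proof. by case: p => [[i j] ?]. Qed.

Lemma sum_at (e : edge n -> vertex) (g : grid_index n -> edge n) (f : grid_index n -> bool) a i j :
  (forall p, (e (g p) == a) = ((val p).1 == i :> nat) && ((val p).2 == j :> nat)) ->
  (\sum_(p : grid_index n) ((e (g p) == a) && f p)
   = if index_at n i j is Some p then f p : nat else 0)%N.
Proof. by move=> E; rewrite -sum_index_at; apply: eq_bigr => p _; rewrite E. Qed.

Lemma sum_at0 (e : edge n -> vertex) (g : grid_index n -> edge n) (f : grid_index n -> bool) a :
  (forall p, (e (g p) == a) = false) ->
  (\sum_(p : grid_index n) ((e (g p) == a) && f p) = 0)%N.
Proof. by move=> E; rewrite big1 // => p _; rewrite E. Qed.

Lemma indegree_top o j : (j < n)%N -> (indegree o (0%N, j.+1) == 1%N) = ~~ vert o 0 j.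
Proof.
move=> jn; rewrite indegreeE.
rewrite (@sum_at0 (fun e => (endpoints e).2) inl) => [|p]; last by rewrite endpoints_inl.
rewrite (@sum_at0 (fun e => (endpoints e).2) inr) => [|p]; last by rewrite endpoints_inr.
rewrite (@sum_at (fun e => (endpoints e).1) inl _ _ 0 j) => [|p]; last first.
  by rewrite endpoints_inl xpair_eqE eqSS.
rewrite (@sum_at0 (fun e => (endpoints e).1) inr) => [|p]; last by rewrite endpoints_inr.
rewrite /vert; have [|p [-> _ _]] := @index_at_ex n 0 j; first by rewrite jn.
by case: (o _).
Qed.

Lemma outdegree_right o i : (i < n)%N ->
  (outdegree o (i.+1, n.+1) == 1%N) = ~~ horiz o i n.-1.
Proof.
move=> lt_in; have n0 : (0 < n)%N by apply: leq_ltn_trans lt_in.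
rewrite outdegreeE.
rewrite (@sum_at0 (fun e => (endpoints e).2) inl) => [|p]; last first.
  by rewrite endpoints_inl xpair_eqE !eqSS andbC (ltn_eqF (ltn_ord _)).
rewrite (@sum_at (fun e => (endpoints e).2) inr _ _ i n.-1) => [|p]; last first.
  by rewrite endpoints_inr xpair_eqE !eqSS -[X in _.+1 == X](prednK n0) eqSS.
rewrite (@sum_at0 (fun e => (endpoints e).1) inl) => [|p]; last first.
  by rewrite endpoints_inl xpair_eqE !eqSS andbC (ltn_eqF (ltn_ord _)).
rewrite (@sum_at0 (fun e => (endpoints e).1) inr) => [|p]; last first.
  by rewrite endpoints_inr xpair_eqE !eqSS andbC (ltn_eqF (ltn_ord _)).
rewrite /horiz; have [|p [-> _ _]] := @index_at_ex n i n.-1.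
  by rewrite -ltnS prednK // lt_in /=.
by case: (o _).
Qed.

Lemma degrees_bulk o i j : (i < j < n)%N ->
  indegree o (i.+1, j.+1)
    = (vert o i j + horiz o i j.-1 + (~~ vert o i.+1 j + ~~ horiz o i j))%N /\
  outdegree o (i.+1, j.+1)
    = (~~ vert o i j + ~~ horiz o i j.-1 + (vert o i.+1 j + horiz o i j))%N.
Proof.
case/andP; case: j => // j ij jn; rewrite indegreeE outdegreeE.
have e1 f : (\sum_(p : grid_index n) (((endpoints (inl p)).2 == (i.+1, j.+2)) && f p)
   = if index_at n i j.+1 is Some p then f p : nat else 0)%N.
  apply: (@sum_at (fun e => (endpoints e).2) inl) => p.
  by rewrite endpoints_inl xpair_eqE !eqSS.
have e2 f : (\sum_(p : grid_index n) (((endpoints (inr p)).2 == (i.+1, j.+2)) && f p)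
   = if index_at n i j is Some p then f p : nat else 0)%N.
  apply: (@sum_at (fun e => (endpoints e).2) inr) => p.
  by rewrite endpoints_inr xpair_eqE !eqSS.
have e3 f : (\sum_(p : grid_index n) (((endpoints (inl p)).1 == (i.+1, j.+2)) && f p)
   = if index_at n i.+1 j.+1 is Some p then f p : nat else 0)%N.
  apply: (@sum_at (fun e => (endpoints e).1) inl) => p.
  by rewrite endpoints_inl xpair_eqE !eqSS.
have e4 f : (\sum_(p : grid_index n) (((endpoints (inr p)).1 == (i.+1, j.+2)) && f p)
   = if index_at n i j.+1 is Some p then f p : nat else 0)%N.
  apply: (@sum_at (fun e => (endpoints e).1) inr) => p.
  by rewrite endpoints_inr xpair_eqE !eqSS.
rewrite !e1 !e2 !e3 !e4 /vert /horiz /=.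
have [|p1 [-> _ _]] := @index_at_ex n i j.+1; first by rewrite jn (ltnW ij).
have [|p2 [-> _ _]] := @index_at_ex n i j; first by rewrite (ij : (i <= j)%N) ltnW.
by have [|p3 [-> _ _]] := @index_at_ex n i.+1 j.+1; first by rewrite jn (ij : (i.+1 <= j.+1)%N).
Qed.

Lemma six_vertexE o : six_vertex o =
  [&& [forall j : 'I_n, ~~ vert o 0 j], [forall i : 'I_n, ~~ horiz o i n.-1]
    & [forall i : 'I_n, forall j : 'I_n, (i < j)%N ==>
         (indegree o (i.+1, j.+1) == 2) && (outdegree o (i.+1, j.+1) == 2)]].
Proof.
congr [&& _, _ & _]; apply: eq_forallb => i.
  exact: indegree_top.
exact: outdegree_right.
Qed.

End Degrees.

(** * The partition function as a transfer recursion *)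

Lemma sum_tuple_cons (A : nmodType) n (P : pred (seq bool)) (F : seq bool -> A) :
  \sum_(t : n.+1.-tuple bool | P t) F t
  = \sum_(b : bool) \sum_(t : n.-tuple bool | P (b :: t)) F (b :: t).
Proof.
rewrite pair_big_dep /=.
rewrite (reindex (fun u : bool * n.-tuple bool => [tuple of u.1 :: u.2])) //=.
exists (fun t => (thead t, [tuple of behead t])) => [[b t] _|t _] /=.
  by congr (_, _); apply: val_inj.
by apply: val_inj; case/tupleP: t.
Qed.

Lemma sum_tuple0 (A : nmodType) (P : pred (seq bool)) (F : seq bool -> A) :
  \sum_(t : 0.-tuple bool | P t) F t = if P [::] then F [::] else 0.
Proof.
rewrite big_mkcond (big_pred1 [tuple]) // => t; apply/esym/eqP.
exact: tuple0.
Qed.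

Section Peeling.
Variable n : nat.

(** An orientation of the larger graph is one of the smaller graph, moved one
    step down and to the right, together with the bits of the first row: [v]
    above its vertices and [h] to the right of them. *)
Definition glue (v h : seq bool) (o : orientation n) : orientation n.+1 :=
  of_coords (fun i j => if i is i'.+1 then vert o i' j.-1 else nth false v j)
            (fun i j => if i is i'.+1 then horiz o i' j.-1 else nth false h j).

Lemma vert_glue v h o i j : (i <= j < n.+1)%N -> vert (glue v h o) i j
  = if i is i'.+1 then vert o i' j.-1 else nth false v j.
Proof. exact: vert_of_coords. Qed.

Lemma horiz_glue v h o i j : (i <= j < n.+1)%N -> horiz (glue v h o) i j
  = if i is i'.+1 then horiz o i' j.-1 else nth false h j.
Proof. exact: horiz_of_coords. Qed.

Lemma sum_glue (A : nmodType) (F : orientation n.+1 -> A) :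
  \sum_(o : orientation n.+1) F o
  = \sum_(v : n.+1.-tuple bool) \sum_(h : n.+1.-tuple bool)
      \sum_(o : orientation n) F (glue v h o).
Proof.
rewrite pair_big pair_big /=.
rewrite (reindex (fun u : n.+1.-tuple bool * n.+1.-tuple bool * orientation n =>
   glue u.1.1 u.1.2 u.2)) //=.
exists (fun o => ([tuple vert o 0 j | j < n.+1], [tuple horiz o 0 j | j < n.+1],
   of_coords (fun i j => vert o i.+1 j.+1) (fun i j => horiz o i.+1 j.+1))).
  move=> [[v h] o] _ /=; congr (_, _, _).
  - by apply: eq_from_tnth => j; rewrite tnth_mktuple vert_glue ?ltn_ord //= (tnth_nth false).
  - by apply: eq_from_tnth => j; rewrite tnth_mktuple horiz_glue ?ltn_ord //= (tnth_nth false).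
  by apply: of_coords_eq => i j ij; rewrite ?vert_glue ?horiz_glue.
move=> o _ /=; apply: of_coords_eq => -[|i] j /= ij.
- by rewrite (nth_mktuple _ _ (Ordinal ij)).
- by case: j ij => // j ij; rewrite vert_of_coords.
- by rewrite (nth_mktuple _ _ (Ordinal ij)).
by case: j ij => // j ij; rewrite horiz_of_coords.
Qed.

End Peeling.

Section StateSum.
Variables (A : comNzRingType) (T : Type).
Variables (K : T -> bool -> bool -> A).
Variables (W : T -> T -> bool -> bool -> bool -> bool -> A).

Definition state_weight n (x : nat -> T) (fv fh : nat -> nat -> bool) : A :=
  (\prod_(i < n) K (x i) (fv i i) (fh i i)) *
  \prod_(i < n) \prod_(j < n | (i < j)%N)
     W (x i) (x j) (fh i j.-1) (fv i j) (fh i j) (fv i.+1 j).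

Definition row_weight x0 n (x : nat -> T) (h al be : seq bool) : A :=
  \prod_(j < n) W x0 (x j) (nth false h j) (nth false al j)
                  (nth false h j.+1) (nth false be j).

Definition right_in n (o : orientation n) := [forall i : 'I_n, ~~ horiz o i n.-1].
Definition tops n (o : orientation n) := [seq vert o 0 j | j <- iota 0 n].

Definition state_sum n (x : nat -> T) (al : seq bool) : A :=
  \sum_(o : orientation n | right_in o && (tops o == al))
     state_weight n x (vert o) (horiz o).

Lemma mkseqS (x : nat -> T) n :
  mkseq x n.+1 = x 0%N :: mkseq (fun i => x i.+1) n.
Proof. by rewrite /mkseq /= -[1%N]addn0 iotaDl -map_comp. Qed.

Lemma grid_row_tuples x0 n (x : nat -> T) h k al : size al = n ->
  grid_row W x0 (mkseq x n) h k al
  = \sum_(hs : n.-tuple bool | ~~ nth false (h :: hs) n)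
      \sum_(be : n.-tuple bool) row_weight x0 n x (h :: hs) al be * k be.
Proof.
elim: n x h k al => [|n IH] x h k [|a al] // => [_|[sz]].
  rewrite (sum_tuple0 (fun hs => ~~ nth false (h :: hs) 0) (fun hs =>
    \sum_(be : 0.-tuple bool) row_weight x0 0 x (h :: hs) [::] be * k be)) /=.
  rewrite (sum_tuple0 xpredT (fun be => row_weight x0 0 x [:: h] [::] be * k be)).
  by rewrite /row_weight big_ord0 mul1r; case: h.
rewrite (sum_tuple_cons n (fun hs => ~~ nth false (h :: hs) n.+1) (fun hs =>
    \sum_(be : n.+1.-tuple bool) row_weight x0 n.+1 x (h :: hs) (a :: al) be * k be)).
rewrite mkseqS /=.
apply: eq_bigr => h' _.
under [in RHS]eq_bigr => hs _.
  rewrite (sum_tuple_cons n xpredT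
   (fun be => row_weight x0 n.+1 x [:: h, h' & hs] (a :: al) be * k be)).
  over.
rewrite [RHS]exchange_big; apply: eq_bigr => b _ /=.
rewrite (IH (fun i => x i.+1) h' (fun bs => k (b :: bs)) al sz) mulr_sumr.
apply: eq_bigr => hs _; rewrite mulr_sumr; apply: eq_bigr => be _.
by rewrite [in RHS]/row_weight big_ord_recl /= -!mulrA.
Qed.

Lemma state_weight_glue n x v h (o : orientation n) :
  state_weight n.+1 x (vert (glue v h o)) (horiz (glue v h o))
  = K (x 0%N) (nth false v 0) (nth false h 0)
    * row_weight (x 0%N) n (fun i => x i.+1) h (behead v) (tops o)
    * state_weight n (fun i => x i.+1) (vert o) (horiz o).
Proof.
rewrite /state_weight big_ord_recl [X in _ * X]big_ord_recl.
rewrite vert_glue // horiz_glue //= -!mulrA; congr (_ * _).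
rewrite [in RHS]mulrCA; congr (_ * _).
  apply: eq_bigr => i _; rewrite /bump /= add1n.
  by rewrite vert_glue ?horiz_glue ?ltnS ?leqnn ?ltn_ord.
congr (_ * _).
  rewrite big_mkcond big_ord_recl /= mul1r /row_weight; apply: eq_bigr => j _.
  rewrite /bump /= add1n add0n !horiz_glue ?vert_glue ?ltnS ?ltn_ord //= 1?ltnW //.
  by rewrite nth_behead (nth_map 0%N) ?size_iota ?nth_iota.
apply: eq_bigr => i _; rewrite big_mkcond big_ord_recl /= mul1r [RHS]big_mkcond.
apply: eq_bigr => j _; rewrite /bump /= !add1n ?add0n ltnS; case: ifP => // ij.
rewrite !horiz_glue ?vert_glue ?ltnS ?ltn_ord //=.
- by rewrite ij.
- by rewrite ltnW.
- by rewrite ltnW.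
by rewrite ij ltnW.
Qed.

Lemma size_tops n (o : orientation n) : size (tops o) == n.
Proof. by rewrite size_map size_iota. Qed.

Lemma tops_glue n (v h : seq bool) (o : orientation n) : size v = n.+1 ->
  tops (glue v h o) = v.
Proof.
move=> sz; rewrite -[RHS](mkseq_nth false) sz; apply/eq_in_map => j.
by rewrite mem_iota add0n => /andP[_ jn]; rewrite vert_glue.
Qed.

Lemma right_in_glue n (v h : seq bool) (o : orientation n) :
  right_in (glue v h o) = ~~ nth false h n && right_in o.
Proof.
have E i : (i <= n)%N -> horiz (glue v h o) i n.+1.-1
    = if i is i'.+1 then horiz o i' n.-1 else nth false h n.
  by move=> le_in; rewrite horiz_glue // le_in ltnSn.
apply/forallP/andP => [r|[h0 /forallP r] i].
  split; first by have := r ord0; rewrite E.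
  by apply/forallP => i; have := r (lift ord0 i); rewrite lift0 E.
rewrite E ?leq_ord //; case: (unliftP ord0 i) => [j ->|-> //].
by rewrite lift0; apply: r.
Qed.

(** The first row of an orientation is split off with [glue]; the sum over the
    remaining rows is then grouped by the bits on top of them. *)
Lemma state_sum_grid n x al : size al = n ->
  state_sum n x al = grid K W (mkseq x n) al.
Proof.
elim: n x al => [|n IH] x al sz.
  case: al sz => // _; rewrite /state_sum.
  rewrite (big_pred1 (of_coords (fun _ _ => false) (fun _ _ => false))).
    by rewrite /state_weight !big_ord0 mulr1.
  move=> o /=; rewrite andbT; transitivity true; first by apply/forallP => -[].
  by apply/esym/eqP/ffunP => -[] [[[]]].
case: al sz => // a al [sz].
rewrite /state_sum big_mkcond sum_glue mkseqS.
have sza : size (a :: al) == n.+1 by rewrite /= sz.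
rewrite (bigD1 (Tuple sza)) //= [X in _ + X]big1 ?addr0 => [|v va]; last first.
  rewrite big1 // => h _; rewrite big1 // => o _; rewrite tops_glue ?size_tuple //.
  by rewrite -(inj_eq val_inj) /= in va; rewrite (negbTE va) andbF.
pose summand (h : seq bool) (o : orientation n) :=
  if ~~ nth false h n && right_in o then
    K (x 0%N) a (nth false h 0) * row_weight (x 0%N) n (fun i => x i.+1) h al (tops o)
      * state_weight n (fun i => x i.+1) (vert o) (horiz o)
  else 0.
transitivity (\sum_(h : n.+1.-tuple bool) \sum_(o : orientation n) summand h o).
  apply: eq_bigr => h _; apply: eq_bigr => o _; rewrite /summand.
  by rewrite tops_glue ?(eqP sza) // right_in_glue eqxx andbT state_weight_glue.
rewrite (sum_tuple_cons n xpredT (fun h => \sum_(o : orientation n) summand h o)).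
apply: eq_bigr => h0 _; rewrite /summand /=.
rewrite grid_row_tuples // mulr_sumr [RHS]big_mkcond; apply: eq_bigr => hs _.
case: ifP => _ /=; last by rewrite big1.
rewrite -big_mkcond (partition_big (fun o => Tuple (size_tops o)) xpredT) //= mulr_sumr.
apply: eq_bigr => be _; rewrite -IH ?size_tuple // /state_sum !mulr_sumr.
apply: eq_big => [o|o /andP[_ /eqP <-]]; first by rewrite -(inj_eq val_inj).
by rewrite mulrA.
Qed.

End StateSum.

(** * Removing the square roots *)

Section Gauge.
Variables (A : comUnitRingType) (s : A).
Local Notation w := (s ^+ 2 - 2%:R).
Implicit Types (u v : A * A).

(** The weights of the model with square roots; a line is the pair of its
    parameter and its square root. *)
Definition tau_bulk u v (h b h' be : bool) : A :=
  match ~~ b, ~~ be, h, h' with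
  | true, false, true, false | false, true, false, true => u.2 * v.2
  | true, true, true, true | false, false, false, false =>
      u.1 + v.1 + w * u.1 * v.1
  | true, true, false, false | false, false, true, true => 1 - u.1 * v.1
  | _, _, _, _ => 0
  end.

Definition tau_left u (a h : bool) : A :=
  match ~~ a, h with
  | true, false => 1
  | false, true => -1
  | true, true | false, false => s * (u.1 / u.2)
  end.

Definition tau_ok u := u.2 \is a GRing.unit /\ u.2 ^+ 2 = tau2 s u.1.

(** The factor of tau is carried by the vertical edges with bit [true]; on the
    horizontal ones it is the factor [u.2 ^+ h] of [gauge_row]. *)
Fixpoint gauge (us : seq (A * A)) (al : seq bool) : A :=
  match us, al with
  | u :: us', a :: al' => u.2 ^+ a * gauge us' al'
  | _, _ => 1
  end.

Lemma gauge_bulk u v (h b h' be : bool) : tau_ok u -> tau_ok v ->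
  v.2 ^+ b * tau_bulk u v h b h' be * u.2 ^+ h'
  = u.2 ^+ h * (poly_bulk s u.1 v.1 h b h' be * v.2 ^+ be).
Proof.
case=> _ tu [_ tv]; case: h b h' be => [] [] [] [];
  rewrite /tau_bulk /poly_bulk /= -?tu -?tv /aweight ?expr0 ?expr1 ?mulr0 ?mul0r //; ring.
Qed.

Lemma gauge_left u (a h : bool) : tau_ok u ->
  u.2 ^+ a * tau_left u a h * u.2 ^+ h = poly_left s u.1 a h.
Proof.
case=> uu tu; case: a h => [] [];
  rewrite /tau_left /poly_left /= -?tu ?expr0 ?expr1 ?mul1r ?mulr1 //.
- by rewrite mulrN1 mulNr.
- by rewrite mulrCA [_ * (_ / _)]mulrC divrK.
by rewrite -mulrA divrK.
Qed.

Lemma gauge_row u us (h : bool) k al : tau_ok u -> (forall v, v \in us -> tau_ok v) ->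
  size al = size us ->
  gauge us al * grid_row tau_bulk u us h k al
  = u.2 ^+ h * grid_row (poly_bulk s) u.1 [seq v.1 | v <- us] h
                 (fun bs => gauge us bs * k bs) al.
Proof.
move=> ku; elim: us h k al => [|v us IH] h k [|b al] //= kus => [_|[sz]].
  by case: h; rewrite /= ?mulr0 ?expr0 ?mul1r.
have kv : tau_ok v by apply: kus; rewrite mem_head.
have {}kus t : t \in us -> tau_ok t by move=> tus; apply: kus; rewrite inE tus orbT.
rewrite !mulr_sumr; apply: eq_bigr => h' _; rewrite !mulr_sumr; apply: eq_bigr => be _.
have -> : v.2 ^+ b * gauge us al * (tau_bulk u v h b h' be *
      grid_row tau_bulk u us h' (fun bs => k (be :: bs)) al)
   = v.2 ^+ b * tau_bulk u v h b h' be *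
     (gauge us al * grid_row tau_bulk u us h' (fun bs => k (be :: bs)) al) by ring.
rewrite IH // mulrA gauge_bulk // -!mulrA -!grid_rowZ.
by apply: eq_grid_row => bs; rewrite !mulrA.
Qed.

Lemma gauge_grid us al : (forall v, v \in us -> tau_ok v) -> size al = size us ->
  gauge us al * grid tau_left tau_bulk us al = pgrid s [seq v.1 | v <- us] al.
Proof.
elim: us al => [|u us IH] [|a al] //= => [_ _|kus [sz]]; first by rewrite mulr1.
have ku : tau_ok u by apply: kus; rewrite mem_head.
have {}kus t : t \in us -> tau_ok t by move=> tus; apply: kus; rewrite inE tus orbT.
rewrite mulr_sumr; apply: eq_bigr => h _.
have -> : u.2 ^+ a * gauge us al * (tau_left u a h *
      grid_row tau_bulk u us h (grid tau_left tau_bulk us) al)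
   = u.2 ^+ a * tau_left u a h *
     (gauge us al * grid_row tau_bulk u us h (grid tau_left tau_bulk us) al) by ring.
rewrite gauge_row // mulrA gauge_left //; congr (_ * _).
by apply: eq_grid_row_size => [|bs szb]; rewrite ?size_map // IH // -(size_map fst).
Qed.

End Gauge.

(** * The partition function of DSASMs *)

Section PartitionFunction.
Variables (A : comUnitRingType) (n : nat) (s : A) (x tau : 'I_n -> A).
Local Notation w := (s ^+ 2 - 2%:R).
Implicit Types (o : orientation n).

Definition line (i : nat) : A * A :=
  nth (0, 1) [seq (x j, tau j) | j <- enum 'I_n] i.

Lemma lineE (i : 'I_n) : line i = (x i, tau i).
Proof. by rewrite /line (nth_map i) ?size_enum_ord ?ltn_ord // nth_ord_enum. Qed.

Lemma mkseq_line : mkseq line n = [seq (x j, tau j) | j <- enum 'I_n].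
Proof.
rewrite -[RHS](mkseq_nth (0, 1)) size_map size_enum_ord.
by apply: eq_map.
Qed.

Lemma left_weightE o (i : 'I_n) :
  left_weight s x tau o i = tau_left s (line i) (vert o i i) (horiz o i i).
Proof.
rewrite /left_weight /tau_left lineE arrow_up ?arrow_right ?leqnn ?ltn_ord //.
Qed.

Lemma bulk_weightE o (i j : 'I_n) : (i < j)%N ->
  bulk_weight w x tau o i j
  = tau_bulk s (line i) (line j) (horiz o i j.-1) (vert o i j) (horiz o i j)
             (vert o i.+1 j).
Proof.
move=> ij; have j0 : (0 < j)%N by apply: leq_ltn_trans ij.
have left_arrow : arrow o (i.+1, j : nat) (i.+1, j.+1) = horiz o i j.-1.
  have := @arrow_right n o i j.-1; rewrite prednK // => -> //.
  rewrite (ltnW (ltn_ord j)) andbT.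
  by rewrite -ltnS prednK.
rewrite /bulk_weight /tau_bulk !lineE left_arrow !arrow_up ?arrow_right //.
- by rewrite ltn_ord ltnW.
- by rewrite ltn_ord ij.
by rewrite ltn_ord ltnW.
Qed.

(** Configurations that violate the rule at a bulk vertex have weight 0 anyway,
    so only the boundary conditions restrict the sum. *)
Lemma bulk_weight_ice o (i j : 'I_n) : (i < j)%N ->
  ~~ ((indegree o (i.+1, j.+1) == 2) && (outdegree o (i.+1, j.+1) == 2)) ->
  bulk_weight w x tau o i j = 0.
Proof.
move=> ij; have [|-> ->] := @degrees_bulk n o i j; first by rewrite ij ltn_ord.
rewrite bulk_weightE // /tau_bulk.
by move: (vert _ _ _) (horiz _ _ _) (vert _ _ _) (horiz _ _ _) => [] [] [] [].
Qed.

Lemma Z_DSASM_state_sum :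
  Z_DSASM w s x tau
  = state_sum (tau_left s) (tau_bulk s) n line (nseq n false).
Proof.
rewrite /Z_DSASM /state_sum big_mkcond [RHS]big_mkcond; apply: eq_bigr => o _.
have cE : config_weight w s x tau o
   = state_weight (tau_left s) (tau_bulk s) n line (vert o) (horiz o).
  congr (_ * _); first by apply: eq_bigr => i _; exact: left_weightE.
  by apply: eq_bigr => i _; apply: eq_bigr => j ij; exact: bulk_weightE.
have tE : (tops o == nseq n false) = [forall j : 'I_n, ~~ vert o 0 j].
  apply/eqP/forallP => [t j|t].
    have -> : vert o 0 j = nth false (tops o) j.
      by rewrite (nth_map 0%N) ?size_iota ?nth_iota ?ltn_ord.
    by rewrite t nth_nseq ltn_ord.
  apply: (@eq_from_nth _ false); rewrite (eqP (size_tops o)) ?size_nseq // => j jn.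
  rewrite nth_nseq jn (nth_map 0%N) ?size_iota ?nth_iota //.
  exact: negbTE (t (Ordinal jn)).
rewrite six_vertexE -cE tE /right_in.
case: [forall j, _] => //=; last by rewrite andbF.
case: [forall j, _] => //=.
case: ifP => // /negbT; rewrite negb_forall => /existsP[i].
rewrite negb_forall => /existsP[j]; rewrite negb_imply => /andP[ij ni].
rewrite /config_weight [X in _ * X](bigD1 i) //= [X in _ * (X * _)](bigD1 j) //=.
by rewrite (bulk_weight_ice ij ni) !mul0r mulr0.
Qed.

Lemma Z_DSASM_Zpol : (forall i, tau i \is a GRing.unit) ->
  (forall i, tau i ^+ 2 = tau2 s (x i)) ->
  Z_DSASM w s x tau = Zpol s [seq x i | i <- enum 'I_n].
Proof.
move=> tu tsq; rewrite Z_DSASM_state_sum state_sum_grid ?size_nseq // mkseq_line.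
set us := map _ _.
have kus v : v \in us -> tau_ok s v by case/mapP => i _ ->; split; [exact: tu | exact: tsq].
have szu : size us = n by rewrite size_map size_enum_ord.
have g1 us' m : gauge us' (nseq m false) = 1 :> A.
  by elim: us' m => [|u us' IH] [|m] //=; rewrite mul1r IH.
have := gauge_grid kus (al := nseq n false); rewrite size_nseq szu g1 mul1r => -> //.
have -> : [seq v.1 | v <- us] = [seq x i | i <- enum 'I_n].
  exact: esym (map_comp _ _ _).
by rewrite /Zpol size_map size_enum_ord.
Qed.

End PartitionFunction.

(** * Summation over all increasing exponents *)

Lemma vanish_powers n (K : fieldType) B (ys : seq (mfps n K)) ks :
  size ks = size ys -> {in ys, forall y, vanish 1 y} ->
  ~~ all (ltn^~ B) ks -> vanish B (powers ys ks).
Proof.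
elim: ys ks => [|y ys IH] [|k ks] //= [sz] v; rewrite negb_and => /orP[|npos].
  rewrite -leqNgt => Bk; rewrite mulrC; apply: vanishMl.
  apply: (vanish_leq Bk) => m; apply: mfps_exp_vanish.
  by apply: (v y (mem_head _ _)); rewrite mdeg0.
apply: vanishMl; apply: IH => // z zys; apply: v; by rewrite inE zys orbT.
Qed.

Theorem theorem1p3 (n : nat) (K : fieldType) (w s : K)
    (tau : 'I_n -> mfps n K)
    (n_gt0 : (0 < n)%N)
    (charK : [pchar K] =i pred0)
    (s_sqrt : s ^+ 2 = w + 2%:R)
    (tau_sqrt : forall i : 'I_n,
       tau i ^+ 2 = - 1 - mfpsC n w * mfpsX K i - mfpsX K i ^+ 2) :
  mfps_has_sum
    [pred k : n.-tuple nat | sorted ltn k]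
    (fun k : n.-tuple nat => mfps_of_mpoly (robbins k 1 1 w))
    ((\prod_(i < n) (1 - mfpsX K i)^-1) *
     (\prod_(i < n) \prod_(j < n | (i < j)%N) (1 - mfpsX K i * mfpsX K j)^-1) *
     Z_DSASM (mfpsC n w) (mfpsC n s) (@mfpsX n K) tau).
Proof.
have wE : w = s ^+ 2 - 2%:R by rewrite s_sqrt addrK.
have mwE : mfpsC n w = mfpsC n s ^+ 2 - 2%:R.
  by rewrite wE /mfpsC !rmorphB !rmorphXn /= !rmorph_nat.
(* The constant term of tau i ^ 2 is - 1. *)
have tau_unit i : tau i \is a GRing.unit.
  have : tau i ^+ 2 \is a GRing.unit.
    rewrite tau_sqrt (_ : _ - _ = - (1 - - (mfpsC n w * mfpsX K i + mfpsX K i ^+ 2))).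
      rewrite unitrN; apply: vanish_unit.
      rewrite expr2 -mulrDl -mulNr; apply: vanishMl; exact: vanish_X.
    by ring.
  by rewrite unitrX_pos.
rewrite mwE Z_DSASM_Zpol => [|//|i]; last by rewrite tau_sqrt mwE.
set T := _ * Zpol _ _; set V := mfps_of_mpoly (vandermonde n K).
pose Xs (p : 'S_n) := [seq mfpsX K (p i) | i <- enum 'I_n].
have VRE (k : n.-tuple nat) : mfps_of_mpoly (robbins k 1 1 w) * V
  = \sum_(p : 'S_n) (-1) ^+ p * (prod_pairs (robbins_factor w) (Xs p) * powers (Xs p) k).
  by rewrite -asym_kernel -robbinsE rmorphM.
have VTE : T * V = \sum_(p : 'S_n) (-1) ^+ p *
    (prod_pairs (robbins_factor w) (Xs p) * incr_series (Xs p)).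
  by rewrite mulrC wE littlewood_mfps.
have vXs p : {in Xs p, forall y, vanish 1 y}.
  by move=> _ /mapP[i _ ->]; apply: vanish_X.
have szXs p : size (Xs p) = n by rewrite size_map size_enum_ord.
have [m0 Vm0] : exists m0, V m0 != 0.
  exists (mlead (vandermonde n K)).
  by rewrite /= mleadc_eq0 vandermonde_neq0.
(* Dividing by V costs mdeg m0 degrees, and the coefficient at m is wanted. *)
move=> m; pose B := ((mdeg m).+1 + mdeg m0)%N.
pose J : seq (n.-tuple nat) := pmap insub (incr_seqs B n).
have JE : map val J = incr_seqs B n.
  rewrite (pmap_filter (insubK _)); apply/all_filterP/allP => ks.
  by rewrite mem_incr_seqs => /andP[sz _]; rewrite isSome_insub.
exists J; split.
- by rewrite -(map_inj_uniq val_inj) JE incr_seqs_uniq.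
- by move=> k kJ; have := map_f val kJ; rewrite JE mem_incr_seqs => /and3P[].
- move=> k ks kJ; have nB : ~~ all (ltn^~ B) k.
    apply: contra kJ => kB; rewrite -(mem_map val_inj) JE mem_incr_seqs size_tuple eqxx.
    by rewrite kB andbT; exact: ks.
  apply: (vanish_cancel Vm0) (ltnSn (mdeg m)).
  rewrite VRE; apply: vanish_sum => p _; apply: vanishMl; apply: vanishMl.
  by apply: vanish_powers => //; rewrite size_tuple szXs.
apply/eqP; rewrite -subr_eq0 -mfps_sum -mfpsN -mfpsD; apply/eqP.
apply: (vanish_cancel Vm0) (ltnSn (mdeg m)).
rewrite mulrBl VTE mulr_suml.
under [X in _ - X]eq_bigr => k _ do rewrite VRE.
rewrite exchange_big -sumrB; apply: vanish_sum => p _.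
rewrite -mulr_sumr -mulrBr -mulr_sumr -mulrBr; apply: vanishMl; apply: vanishMl.
rewrite -opprB -mulN1r; apply: vanishMl.
rewrite -(big_map val xpredT (powers (Xs p))) JE.
by have := @sum_powers_incr_series n K B _ (vXs p); rewrite szXs.
Qed.
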